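(* Let $E$ be a real Banach lattice and let $S$ be a positive and irreducible semigroup on $E$ with growth bound $\omega_0(S)=0$. If $S$ is asymptotically compact, then there exist a quasi-interior point $u\in E_+$ and a strictly positive functional $\varphi\in E'$ such that $S(t)$ converges with respect to the operator norm to the operator $\varphi\otimes u$ (defined by $f\mapsto\langle\varphi,f\rangle u$) as $t\to\infty$.
   Context: A semigroup on $E$ is a map $S:(0,\infty)\to\mathcal{L}(E)$ with $S(s+t)=S(t)S(s)$ for all $s,t>0$ and $\sup_{t\in(0,1]}\|S(t)\|<\infty$; no time continuity is assumed. $S$ is positive if each $S(t)$ maps $E_+$ into $E_+$. A positive semigroup is irreducible if for every $0<f\in E$ and every $0<\varphi\in E'$ (where $0<x$ means $x\ge0$, $x\neq0$) there exists $t>0$ with $\langle\varphi,S(t)f\rangle>0$. The growth bound is $\omega_0(S)=\inf\{w\in\mathbb{R}:\ \exists M\ge0 \text{ with } \|S(t)\|\le Me^{wt}\ \forall t>0\}$. The essential norm of $R\in\mathcal{L}(E)$ is $\|R\|_{\mathrm{ess}}=\inf\{\|R-K\|:\ K \text{ compact}\}$; $S$ is asymptotically compact if $\lim_{t\to\infty}\|S(t)\|_{\mathrm{ess}}=0$ (equivalently, $\|S(t)\|_{\mathrm{ess}}<1$ for some $t>0$). A vector $u\in E_+$ is a quasi-interior point if $\lim_{n\to\infty}v\wedge(nu)=v$ for all $v\in E_+$; $\varphi\in E'$ is strictly positive if $\langle\varphi,f\rangle>0$ for all $0<f\in E$. *)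

(* Defs.v *)
From HB Require Import structures.
From mathcomp Require Import all_boot all_order all_algebra.
From mathcomp Require Import all_classical all_reals all_analysis.
Set Implicit Arguments. Unset Strict Implicit. Unset Printing Implicit Defensive.
Import Order.TTheory GRing.Theory Num.Theory.
Import numFieldNormedType.Exports.
Local Open Scope classical_set_scope.
Local Open Scope ring_scope.

Section Defs.
Variables (R : realType) (E : completeNormedModType R).

Record banach_lattice := BanachLattice {
  bl_le : E -> E -> Prop;
  bl_join : E -> E -> E;
  bl_refl : forall x, bl_le x x;
  bl_antisym : forall x y, bl_le x y -> bl_le y x -> x = y;
  bl_trans : forall x y z, bl_le x y -> bl_le y z -> bl_le x z;
  bl_add : forall x y z, bl_le x y -> bl_le (x + z) (y + z);
  bl_scale : forall (a : R) x y, 0 <= a -> bl_le x y -> bl_le (a *: x) (a *: y);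
  bl_join_l : forall x y, bl_le x (bl_join x y);
  bl_join_r : forall x y, bl_le y (bl_join x y);
  bl_join_least : forall x y z, bl_le x z -> bl_le y z -> bl_le (bl_join x y) z;
  bl_norm : forall x y, bl_le (bl_join x (- x)) (bl_join y (- y)) -> `|x| <= `|y|
}.

Variable L : banach_lattice.

Definition bl_meet (x y : E) : E := - bl_join L (- x) (- y).
Definition bl_pos (x : E) : Prop := bl_le L 0 x.
Definition bl_spos (x : E) : Prop := bl_pos x /\ x <> 0.

Definition bounded_op (T : E -> E) : Prop :=
  (forall (a : R) x y, T (a *: x + y) = a *: T x + T y) /\
  exists M : R, forall x, `|T x| <= M * `|x|.

Definition dual_elt (phi : E -> R) : Prop :=
  (forall (a : R) x y, phi (a *: x + y) = a * phi x + phi y) /\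
  exists M : R, forall x, `|phi x| <= M * `|x|.

Definition opnorm (T : E -> E) : R :=
  inf [set M : R | 0 <= M /\ forall x, `|T x| <= M * `|x|].

Definition compact_op (K : E -> E) : Prop :=
  bounded_op K /\ compact (closure (K @` [set x : E | `|x| <= 1])).

Definition essnorm (T : E -> E) : R :=
  inf [set opnorm (T \- K) | K in compact_op].

(* semigroup on E (no time continuity) *)
Definition semigroup (S : R -> E -> E) : Prop :=
  (forall t, 0 < t -> bounded_op (S t)) /\
  (forall s t, 0 < s -> 0 < t -> S (s + t) = S t \o S s) /\
  exists M : R, forall t, 0 < t -> t <= 1 -> opnorm (S t) <= M.

Definition positive_sg (S : R -> E -> E) : Prop :=
  forall t, 0 < t -> forall f, bl_pos f -> bl_pos (S t f).

Definition spos_functional (phi : E -> R) : Prop :=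
  dual_elt phi /\ (forall f, bl_pos f -> 0 <= phi f) /\ exists f, phi f <> 0.

Definition irreducible_sg (S : R -> E -> E) : Prop :=
  forall f phi, bl_spos f -> spos_functional phi ->
    exists t, 0 < t /\ 0 < phi (S t f).

Definition growth_bound (S : R -> E -> E) : \bar R :=
  ereal_inf [set w%:E | w in [set w : R | exists M : R, 0 <= M /\
     forall t, 0 < t -> opnorm (S t) <= M * expR (w * t)]].

Definition asymptotically_compact (S : R -> E -> E) : Prop :=
  essnorm (S t) @[t --> +oo] --> (0 : R).

Definition quasi_interior (u : E) : Prop :=
  bl_pos u /\ forall v, bl_pos v -> bl_meet v (n%:R *: u) @[n --> \oo] --> v.

Definition strictly_positive (phi : E -> R) : Prop :=
  dual_elt phi /\ forall f, bl_spos f -> 0 < phi f.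

Definition rank_one (phi : E -> R) (u : E) : E -> E := fun f => phi f *: u.

End Defs.

(* Main.v *)
Require Import Defs.
From HB Require Import structures.
From mathcomp Require Import all_boot all_order all_algebra.
From mathcomp Require Import all_classical all_reals all_analysis.
From mathcomp Require Import ring lra.
Import Order.TTheory GRing.Theory Num.Theory.
Import numFieldNormedType.Exports.
Local Open Scope classical_set_scope.
Local Open Scope ring_scope.
Set Implicit Arguments. Unset Strict Implicit. Unset Printing Implicit Defensive.

(** Write T = S 1. Since the growth bound is 0, the sums of w^n T^n blow up as
    w tends to 1, so their normalisations A_k are almost T-invariant.
    Hahn-Banach below lim_k |(A_k x)^+| (a limit along a free ultrafilter)
    produces a positive T-invariant functional phi, nonzero by asymptotic
    compactness. If S were unbounded, the normalised images at record times of
    |T^n| would accumulate at a positive vector annihilated by all phi o S s,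
    against irreducibility; so S is bounded, and then S(t_n) x_n has a limit
    along the ultrafilter for all bounded x_n and t_n -> oo.
    These limits have bounded preimages under every S t ("reversible" vectors);
    they are recurrent under T, and recurrence together with phi shows that each
    S t acts on them as a lattice automorphism. Their unit ball is totally
    bounded, so there are atoms, finitely many up to scaling; S t permutes the
    rays they span, trivially so because t is divisible by N! in (0, oo). An
    atom is therefore an eigenvector of all S t, hence quasi-interior by
    irreducibility, and spans all reversible vectors. Uniform convergence
    follows since every limit of S(t_n) x_n is a multiple of this one vector,
    determined by phi. *)

(** * Hahn-Banach *)

Section HahnBanach.
Variables (R : realType) (V : lmodType R).
Implicit Types (p q : V -> R) (x y v : V).

Definition sublinear p :=
  (forall (a : R) x, 0 <= a -> p (a *: x) = a * p x) /\
  (forall x y, p (x + y) <= p x + p y).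

Lemma sublinear0 p : sublinear p -> p 0 = 0.
Proof. by case=> h _; rewrite -(scale0r (0 : V)) h // mul0r. Qed.

Lemma sublinear_oppr_ge p x : sublinear p -> - p (- x) <= p x.
Proof.
move=> sp; have := sp.2 x (- x).
by rewrite subrr sublinear0 // -lerBlDr sub0r.
Qed.

(** For sublinear [p], this is the largest sublinear functional below [p] whose value at [- v] is at
    most [- p v]. *)
Definition tilt p v x := inf [set p (x + t *: v) - t * p v | t in [set t : R | 0 <= t]].

Section tilt.
Variables (p : V -> R) (v : V).
Hypothesis sp : sublinear p.

(** The lower bound makes the infimum genuine: for a set unbounded below, [inf] would return a
    default value. *)
Let lb x : lbound [set p (x + t *: v) - t * p v | t in [set t : R | 0 <= t]]
  (- p (- x)).
Proof.
move=> _ [t t0 <-]; rewrite lerBrDr -sp.1 // addrC lerBlDr.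
by apply: le_trans (sp.2 _ _); rewrite addrAC subrr add0r.
Qed.

Lemma tilt_le_at x (t : R) : 0 <= t -> tilt p v x <= p (x + t *: v) - t * p v.
Proof. by move=> t0; apply: ge_inf; [exists (- p (- x)); exact: lb|exists t]. Qed.

Lemma tilt_ge x (c : R) :
  (forall t, 0 <= t -> c <= p (x + t *: v) - t * p v) -> c <= tilt p v x.
Proof.
move=> h; apply: lb_le_inf; first by exists (p (x + 0 *: v) - 0 * p v), 0 => /=.
by move=> _ [t t0 <-]; exact: h.
Qed.

Lemma tilt_le x : tilt p v x <= p x.
Proof. by have := tilt_le_at x (lexx 0); rewrite scale0r addr0 mul0r subr0. Qed.

Lemma tiltN : tilt p v (- v) <= - p v.
Proof.
have := tilt_le_at (- v) ler01.
by rewrite scale1r addNr sublinear0 // sub0r mul1r.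
Qed.

(** Parameters [t] for [x] and [s] for [y] combine to the admissible parameter [t + s] for [x + y].
    For homogeneity one inequality suffices, since applying it to [a^-1] gives the other. *)
Lemma sublinear_tilt : sublinear (tilt p v).
Proof.
have tilt0 : tilt p v 0 = 0.
  apply/eqP; rewrite eq_le; apply/andP; split.
    by apply: le_trans (tilt_le _) _; rewrite sublinear0.
  by apply: tilt_ge => t t0; rewrite add0r sp.1 // subrr.
have half (a : R) x : 0 < a -> a * tilt p v x <= tilt p v (a *: x).
  move=> a0; apply: tilt_ge => t t0.
  have ta : 0 <= t / a by rewrite divr_ge0 // ltW.
  have e : a * (t / a) = t by rewrite mulrC divfK ?gt_eqF.
  rewrite -ler_pdivlMl //; apply: le_trans (tilt_le_at x ta) _.
  rewrite ler_pdivlMl // mulrBr -(sp.1 a) ?(ltW a0)// scalerDr scalerA.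
  by rewrite [a * (_ * p v)]mulrA e.
split=> [a x|x y].
  rewrite le_eqVlt => /predU1P[<-|a0]; first by rewrite scale0r mul0r.
  apply/eqP; rewrite eq_le half // andbT.
  have := half a^-1 (a *: x); rewrite invr_gt0 a0 => /(_ isT).
  by rewrite scalerA mulVf ?gt_eqF// scale1r ler_pdivrMl.
rewrite -lerBlDr; apply: tilt_ge => t t0; rewrite lerBlDr -lerBlDl.
apply: tilt_ge => s s0; rewrite lerBlDl.
apply: le_trans (tilt_le_at _ (addr_ge0 t0 s0)) _.
have := sp.2 (x + t *: v) (y + s *: v).
rewrite addrACA -scalerDl; set A := p _; set B := p _; set C := p _ => h.
by rewrite mulrDl; lra.
Qed.

End tilt.

(* Zorn is applied to the sublinear functionals below p, not to partially defined linear
   ones: tilting a minimal one by v does not change it, which forces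
   q (- v) = - q v. *)
Theorem hahn_banach p v : sublinear p ->
  exists f : V -> R, [/\ forall (a : R) x y, f (a *: x + y) = a * f x + f y,
    forall x, f x <= p x & f v = p v].
Proof.
(* The search takes place below [tilt p v] instead of [p]: this forces [q (- v) <= - p v], so a
   linear [q] attains [p v] at [v]. *)
move=> sp; set p' := tilt p v; have sp' : sublinear p' by exact: sublinear_tilt.
pose T := {q : V -> R | sublinear q /\ forall x, q x <= p' x}.
(* The order is reversed, so a maximal element is a minimal functional. Chains are bounded by their
   pointwise infimum [m], the empty one by [p']. *)
pose le (q1 q2 : T) : bool := `[< forall x, sval q2 x <= sval q1 x >].
have [|||A totA|[q [sq qp]] qmin] := @Zorn T le.
- by move=> q; apply/asboolP => x.
- move=> q r s /asboolP qr /asboolP rs; apply/asboolP => x.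
  exact: le_trans (rs x) (qr x).
- move=> [q hq] [r hr] /asboolP /= qr /asboolP /= rq; apply: eq_exist.
  by apply/funext => x; apply/eqP; rewrite eq_le rq qr.
- have [[q0 Aq0]|A0] := pselect (A !=set0); last first.
    by exists (exist _ p' (conj sp' (fun x => lexx _))) => q Aq; case: A0; exists q.
  pose B x := [set sval q x | q in A]; pose m x := inf (B x).
  have Bn0 x : B x !=set0 by exists (sval q0 x), q0.
  have lbB x : lbound (B x) (- p' (- x)).
    move=> _ [q Aq <-]; apply: le_trans (sublinear_oppr_ge x (svalP q).1).
    by rewrite lerN2; exact: (svalP q).2.
  have mle (q : T) x : A q -> m x <= sval q x.
    by move=> Aq; apply: ge_inf; [exists (- p' (- x)); exact: lbB|exists q].
  have mge c x : (forall q : T, A q -> c <= sval q x) -> c <= m x.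
    by move=> h; apply: lb_le_inf => // _ [q Aq <-]; exact: h.
  have sm : sublinear m.
    split=> [a x a0|x y].
      apply/eqP; rewrite eq_le; apply/andP; split; last first.
        by apply: (mge _ _) => q Aq; rewrite (svalP q).1.1 // ler_wpM2l // mle.
      move: a0; rewrite [0 <= a]le_eqVlt => /predU1P[<-|a0].
        rewrite scale0r mul0r; apply: le_trans (mle _ _ Aq0) _.
        by rewrite sublinear0 //; exact: (svalP q0).1.
      rewrite -ler_pdivrMl //; apply: (mge _ _) => q Aq.
      by rewrite ler_pdivrMl // -(svalP q).1.1 ?mle // ltW.
    rewrite -lerBlDr; apply: (mge _ _) => q Aq; rewrite lerBlDr -lerBlDl.
    apply: (mge _ _) => r Ar; rewrite lerBlDl.
    (* One member of the chain approximates [m x], another [m y]; the smaller of the two serves for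
       both. *)
    have [/asboolP qr|/asboolP rq] := totA _ _ Aq Ar.
      apply: le_trans (mle _ _ Ar) _; apply: le_trans ((svalP r).1.2 _ _) _.
      by rewrite lerD2r.
    apply: le_trans (mle _ _ Aq) _; apply: le_trans ((svalP q).1.2 _ _) _.
    by rewrite lerD2l.
  have mp x : m x <= p' x by apply: le_trans (mle _ x Aq0) _; exact: (svalP q0).2.
  exists (exist _ m (conj sm mp)) => q Aq; apply/asboolP => x /=; exact: mle.
- have qN x : q (- x) = - q x.
    have h : sublinear (tilt q x) /\ forall y, tilt q x y <= p' y.
      split; first exact: sublinear_tilt.
      by move=> y; apply: le_trans (tilt_le _ sq _) _.
    have /(congr1 sval)/= e : exist _ (tilt q x) h = exist _ q (conj sq qp) :> T.
      by apply: qmin; apply/asboolP => y /=; exact: tilt_le.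
    apply/eqP; rewrite eq_le; apply/andP; split.
      by rewrite -[in leLHS]e; exact: tiltN.
    by rewrite lerNl; exact: sublinear_oppr_ge.
  have qD x y : q (x + y) = q x + q y.
    apply/eqP; rewrite eq_le sq.2 /=; have := sq.2 (x + y) (- y).
    by rewrite addrK qN lerBrDr.
  have qp0 x : q x <= p x by apply: le_trans (qp x) _; exact: tilt_le.
  exists q; split=> //.
    move=> a x y; rewrite qD; congr (_ + _); have [a0|a0] := leP 0 a.
      by rewrite sq.1.
    by rewrite -[a *: x]opprK -scaleNr qN sq.1 ?oppr_ge0 1?ltW// mulNr opprK.
  apply/eqP; rewrite eq_le qp0 /=.
  have : q (- v) <= - p v by apply: le_trans (qp _) _; exact: tiltN.
  by rewrite qN lerN2.
Qed.

End HahnBanach.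

(** * Banach lattices and positive operators *)

Section LinearMaps.
Variables (R : realType) (V W : lmodType R) (f : V -> W).
Hypothesis fL : forall (a : R) x y, f (a *: x + y) = a *: f x + f y.

Lemma lin_add x y : f (x + y) = f x + f y.
Proof. by have := fL 1 x y; rewrite !scale1r. Qed.

Lemma lin_zero : f 0 = 0.
Proof. by apply/(addrI (f 0)); rewrite -lin_add !addr0. Qed.

Lemma lin_scale (a : R) x : f (a *: x) = a *: f x.
Proof. by have := fL a x 0; rewrite !addr0 lin_zero addr0. Qed.

Lemma lin_opp x : f (- x) = - f x.
Proof. by rewrite -scaleN1r lin_scale scaleN1r. Qed.

Lemma lin_sub x y : f (x - y) = f x - f y.
Proof. by rewrite lin_add lin_opp. Qed.

End LinearMaps.

Section BanachLattice.
Variables (R : realType) (E : completeNormedModType R) (L : banach_lattice E).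
Implicit Types (x y z : E).

Local Notation "x <=L y" := (bl_le L x y) (at level 70, y at next level).
Definition bl_abs x := bl_join L x (- x).
Definition bl_pp x := bl_join L x 0.
Local Notation abs := bl_abs.
Local Notation pp := bl_pp.

Lemma bl_subr_ge0 x y : 0 <=L y - x <-> x <=L y.
Proof.
split=> h; last by rewrite -(subrr x); exact: bl_add.
by rewrite -[x]add0r -[y](subrK x); exact: bl_add.
Qed.

Lemma bl_leD x y z t : x <=L y -> z <=L t -> x + z <=L y + t.
Proof.
move=> xy zt; apply: (bl_trans (bl_add z xy)).
by rewrite ![y + _]addrC; exact: bl_add.
Qed.

Lemma bl_leN x y : x <=L y -> - y <=L - x.
Proof. by move=> /bl_subr_ge0 h; apply/bl_subr_ge0; rewrite opprK addrC. Qed.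

Lemma bl_addr_ge0 x y : 0 <=L x -> 0 <=L y -> 0 <=L x + y.
Proof. by move=> x0 y0; rewrite -(addr0 0); exact: bl_leD. Qed.

Lemma bl_scaler_ge0 (a : R) x : 0 <= a -> 0 <=L x -> 0 <=L a *: x.
Proof. by move=> a0 x0; rewrite -(scaler0 _ a); exact: bl_scale. Qed.

Lemma bl_ler_scale (a b : R) x : a <= b -> 0 <=L x -> a *: x <=L b *: x.
Proof.
move=> ab x0; apply/bl_subr_ge0; rewrite -scalerBl.
by apply: bl_scaler_ge0; rewrite ?subr_ge0.
Qed.

Lemma bl_sumr_ge0 (I : Type) (r : seq I) (F : I -> E) :
  (forall i, 0 <=L F i) -> 0 <=L \sum_(i <- r) F i.
Proof.
move=> h; elim: r => [|i r ih]; first by rewrite big_nil; exact: bl_refl.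
by rewrite big_cons; exact: bl_addr_ge0.
Qed.

Lemma bl_joinD x y z : bl_join L (x + z) (y + z) = bl_join L x y + z.
Proof.
apply: (@bl_antisym _ _ L).
  by apply: bl_join_least; apply: bl_add; [exact: bl_join_l|exact: bl_join_r].
rewrite -[X in _ <=L X](subrK z); apply: bl_add.
apply: bl_join_least; rewrite -[X in X <=L _](addrK z); apply: bl_add.
  exact: bl_join_l.
exact: bl_join_r.
Qed.

Lemma bl_joinC x y : bl_join L x y = bl_join L y x.
Proof.
apply: (@bl_antisym _ _ L); apply: bl_join_least;
  by [exact: bl_join_l|exact: bl_join_r].
Qed.

Lemma bl_joinZ (a : R) x y : 0 < a ->
  bl_join L (a *: x) (a *: y) = a *: bl_join L x y.
Proof.
have h (b : R) u v : 0 < b -> bl_join L (b *: u) (b *: v) <=L b *: bl_join L u v.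
  move=> b0; apply: bl_join_least; apply: bl_scale; rewrite ?(ltW b0)//.
    exact: bl_join_l.
  exact: bl_join_r.
move=> a0; apply: (@bl_antisym _ _ L); first exact: h.
have ai : 0 < a^-1 by rewrite invr_gt0.
have := bl_scale (ltW a0) (h _ (a *: x) (a *: y) ai).
by rewrite !scalerA mulVf ?divff ?gt_eqF// !scale1r.
Qed.

Lemma bl_pp_ge0 x : 0 <=L pp x. Proof. exact: bl_join_r. Qed.
Lemma bl_pp_ge x : x <=L pp x. Proof. exact: bl_join_l. Qed.

Lemma bl_pp_id x : 0 <=L x -> pp x = x.
Proof.
move=> x0; apply: (@bl_antisym _ _ L); last exact: bl_pp_ge.
by apply: bl_join_least => //; exact: bl_refl.
Qed.

Lemma bl_pp_eq0 x : x <=L 0 -> pp x = 0.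
Proof.
move=> x0; apply: (@bl_antisym _ _ L); last exact: bl_pp_ge0.
by apply: bl_join_least => //; exact: bl_refl.
Qed.

Lemma bl_pp0 : pp 0 = 0. Proof. exact/bl_pp_id/bl_refl. Qed.

Lemma bl_ppN x : pp (- x) = pp x - x.
Proof. by rewrite /pp bl_joinC -bl_joinD subrr add0r. Qed.

Lemma bl_pp_sub x : pp x - pp (- x) = x.
Proof. by rewrite bl_ppN opprB addrC subrK. Qed.

Lemma bl_ppZ (a : R) x : 0 <= a -> pp (a *: x) = a *: pp x.
Proof.
rewrite le_eqVlt => /predU1P[<-|a0]; first by rewrite !scale0r bl_pp0.
by rewrite /pp -{1}(scaler0 _ a) bl_joinZ.
Qed.

Lemma bl_le_pp x y : x <=L y -> pp x <=L pp y.
Proof.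
move=> xy; apply: bl_join_least; last exact: bl_pp_ge0.
exact: (bl_trans xy (bl_pp_ge _)).
Qed.

Lemma bl_ppD x y : pp (x + y) <=L pp x + pp y.
Proof.
apply: bl_join_least; first by apply: bl_leD; exact: bl_pp_ge.
by apply: bl_addr_ge0; exact: bl_pp_ge0.
Qed.

(** Translation by [- x] turns the join of [2 x] and [0] into the join of [x] and [- x]. *)
Lemma bl_absE x : abs x = pp x + pp (- x).
Proof.
rewrite bl_ppN addrA; have -> : abs x = bl_join L (2 *: x) (2 *: 0) - x.
  by rewrite -bl_joinD scaler0 add0r scaler_nat mulr2n addrK.
by rewrite bl_joinZ // scaler_nat mulr2n.
Qed.

Lemma bl_abs_ge x : x <=L abs x. Proof. exact: bl_join_l. Qed.
Lemma bl_abs_geN x : - x <=L abs x. Proof. exact: bl_join_r. Qed.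

Lemma bl_abs_ge0 x : 0 <=L abs x.
Proof. by rewrite bl_absE; apply: bl_addr_ge0; exact: bl_pp_ge0. Qed.

Lemma bl_absN x : abs (- x) = abs x.
Proof. by rewrite /abs opprK bl_joinC. Qed.

Lemma bl_abs_id x : 0 <=L x -> abs x = x.
Proof.
move=> x0; rewrite bl_absE (bl_pp_id x0) bl_pp_eq0 ?addr0//.
by rewrite -[0]oppr0; exact: bl_leN.
Qed.

Lemma bl_abs_least x y : x <=L y -> - x <=L y -> abs x <=L y.
Proof. exact: bl_join_least. Qed.

Lemma bl_absD x y : abs (x + y) <=L abs x + abs y.
Proof.
apply: bl_abs_least; first by apply: bl_leD; exact: bl_abs_ge.
by rewrite opprD; apply: bl_leD; exact: bl_abs_geN.
Qed.

Lemma bl_norm_le_abs x y : abs x <=L abs y -> `|x| <= `|y|.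
Proof. exact: bl_norm. Qed.

Lemma bl_norm_abs x : `|abs x| = `|x|.
Proof.
by apply/eqP; rewrite eq_le; apply/andP; split; apply: bl_norm_le_abs;
  rewrite (bl_abs_id (bl_abs_ge0 x)); exact: bl_refl.
Qed.

Lemma bl_norm_le x y : 0 <=L x -> x <=L y -> `|x| <= `|y|.
Proof.
move=> x0 xy; apply: bl_norm_le_abs; rewrite bl_abs_id // bl_abs_id //.
exact: bl_trans xy.
Qed.

Lemma bl_norm_le_of_abs x y : abs x <=L y -> `|x| <= `|y|.
Proof.
by move=> h; rewrite -bl_norm_abs; apply: bl_norm_le => //; exact: bl_abs_ge0.
Qed.

Lemma bl_pp_le_abs x : pp x <=L abs x.
Proof. by apply: bl_join_least; [exact: bl_abs_ge|exact: bl_abs_ge0]. Qed.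

Lemma bl_norm_pp x : `|pp x| <= `|x|.
Proof.
by rewrite -(bl_norm_abs x); apply: bl_norm_le; [exact: bl_pp_ge0|exact: bl_pp_le_abs].
Qed.

Lemma bl_norm_ppB x y : `|pp x - pp y| <= `|x - y|.
Proof.
rewrite -(bl_norm_abs (x - y)); apply: bl_norm_le_of_abs.
have h u v : pp u - pp v <=L abs (u - v).
  apply: bl_trans (bl_pp_le_abs _); apply/bl_subr_ge0.
  rewrite opprB addrA; apply/bl_subr_ge0.
  by rewrite -{1}(subrK v u); exact: bl_ppD.
by apply: bl_abs_least => //; rewrite opprB -(bl_absN (x - y)) opprB.
Qed.

Lemma bl_norm_absB x y : `|abs x - abs y| <= `|x - y|.
Proof.
rewrite -(bl_norm_abs (x - y)); apply: bl_norm_le_of_abs.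
have h u v : abs u - abs v <=L abs (u - v).
  apply/bl_subr_ge0; rewrite opprB addrA; apply/bl_subr_ge0.
  by rewrite -{1}(subrK v u); exact: bl_absD.
by apply: bl_abs_least => //; rewrite opprB -(bl_absN (x - y)) opprB.
Qed.

(** The negative part is 1-Lipschitz and vanishes exactly on the positive cone, so the cone is
    closed. *)
Lemma bl_ge0_closed x :
  (forall e : R, 0 < e -> exists2 y, 0 <=L y & `|x - y| <= e) -> 0 <=L x.
Proof.
move=> h; suff ppNx : pp (- x) = 0.
  by rewrite -(bl_pp_sub x) ppNx subr0; exact: bl_pp_ge0.
apply/normr0_eq0/eqP; rewrite eq_le normr_ge0 andbT.
apply/ler_addgt0Pr => e e0; rewrite add0r; have [y y0 xy] := h e e0.
apply: le_trans xy; have ppNy : pp (- y) = 0.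
  by apply: bl_pp_eq0; rewrite -[0]oppr0; exact: bl_leN.
by have := bl_norm_ppB (- x) (- y); rewrite ppNy subr0 -opprD normrN.
Qed.

Lemma bl_le_closed x y :
  (forall e : R, 0 < e -> exists2 z, `|z| <= e & x <=L y + z) -> x <=L y.
Proof.
move=> h; apply/bl_subr_ge0/bl_ge0_closed => e e0; have [z ze xyz] := h e e0.
exists (y + z - x); first exact/bl_subr_ge0.
by rewrite opprB addrA subrK opprD addrA subrr sub0r normrN.
Qed.

Lemma bl_meetE x y : bl_meet L x y = x - pp (x - y).
Proof.
rewrite /bl_meet /pp bl_joinC.
have -> : bl_join L (- y) (- x) = bl_join L (x - y) 0 - x.
  by rewrite -bl_joinD addrAC subrr !add0r.
by rewrite opprB.
Qed.

Lemma bl_meetC x y : bl_meet L x y = bl_meet L y x.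
Proof. by rewrite /bl_meet bl_joinC. Qed.

Lemma bl_meet_l x y : bl_meet L x y <=L x.
Proof. by rewrite -[X in _ <=L X]opprK; apply: bl_leN; exact: bl_join_l. Qed.

Lemma bl_meet_r x y : bl_meet L x y <=L y.
Proof. by rewrite bl_meetC; exact: bl_meet_l. Qed.

Lemma bl_meet_greatest x y z : z <=L x -> z <=L y -> z <=L bl_meet L x y.
Proof.
move=> zx zy; rewrite -[X in X <=L _]opprK; apply: bl_leN.
by apply: bl_join_least; exact: bl_leN.
Qed.

Lemma bl_meet_mono x y x' y' : x <=L x' -> y <=L y' ->
  bl_meet L x y <=L bl_meet L x' y'.
Proof.
move=> xx yy; apply: bl_meet_greatest.
  exact: bl_trans (bl_meet_l _ _) xx.
exact: bl_trans (bl_meet_r _ _) yy.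
Qed.

Lemma bl_meet_pp x : bl_meet L (pp x) (pp (- x)) = 0.
Proof. by rewrite bl_meetE bl_pp_sub subrr. Qed.

Lemma bl_meet0_sub x y x' y' : 0 <=L x -> 0 <=L y -> x <=L x' -> y <=L y' ->
  bl_meet L x' y' = 0 -> bl_meet L x y = 0.
Proof.
move=> x0 y0 xx yy d; apply: (@bl_antisym _ _ L).
  by rewrite -d; exact: bl_meet_mono.
exact: bl_meet_greatest.
Qed.

Lemma bl_abs_disjoint x y : bl_meet L x y = 0 -> abs (x - y) = x + y.
Proof.
move=> d; rewrite bl_absE opprB.
have /eqP := d; rewrite bl_meetE subr_eq0 => /eqP <-.
by move: d; rewrite bl_meetC bl_meetE => /eqP; rewrite subr_eq0 => /eqP <-.
Qed.

Lemma bl_norm_disjoint x y : 0 <=L x -> 0 <=L y -> bl_meet L x y = 0 ->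
  `|x| <= `|x - y|.
Proof.
move=> x0 y0 d; rewrite -(bl_norm_abs (x - y)) (bl_abs_disjoint d).
apply: bl_norm_le => //; rewrite -{1}(addr0 x).
by apply: bl_leD => //; exact: bl_refl.
Qed.

Lemma bl_pp_abs x : pp x = 2^-1 *: (x + abs x).
Proof.
rewrite bl_absE bl_ppN addrC addrA subrK -mulr2n -(scaler_nat 2 (pp x)) scalerA.
by rewrite mulVf // scale1r.
Qed.

Lemma bl_meetZ (c : R) x y : 0 <= c -> bl_meet L (c *: x) (c *: y) = c *: bl_meet L x y.
Proof. by move=> c0; rewrite !bl_meetE -scalerBr bl_ppZ // -scalerBr. Qed.

Lemma bl_meet0Z (c d : R) x y : 0 <= c -> 0 <= d -> 0 <=L x -> 0 <=L y ->
  bl_meet L x y = 0 -> bl_meet L (c *: x) (d *: y) = 0.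
Proof.
move=> c0 d0 x0 y0 xy.
have h : bl_meet L (Num.max c d *: x) (Num.max c d *: y) = 0.
  by rewrite bl_meetZ ?xy ?scaler0 // le_max c0.
apply: bl_meet0_sub h; [exact: bl_scaler_ge0|exact: bl_scaler_ge0| |];
  by apply: bl_ler_scale => //; rewrite le_max lexx ?orbT.
Qed.

(** The factor is the supremum [s] of all [c] with [c a <= b]. Just above [s] comparability forces
    [b <= c a], and closedness of the cone carries both inequalities to [s]. *)
Lemma bl_comparable_multiple a b : 0 <=L a -> 0 <=L b -> b <=L a ->
  (forall c : R, 0 <= c <= 1 -> b <=L c *: a \/ c *: a <=L b) ->
  exists c : R, b = c *: a.
Proof.
move=> a0 b0 ba h; pose A := [set c : R | 0 <= c <= 1 /\ c *: a <=L b].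
have A0 : A 0 by rewrite /A /= scale0r lexx ler01.
have supA : has_sup A by split; [exists 0|exists 1 => c [/andP[]]].
pose s := sup A; exists s.
have s0 : 0 <= s by apply: ub_le_sup => //; exact: supA.2.
have s1 : s <= 1 by apply: ge_sup; [exists 0|move=> c [/andP[]]].
have an : 0 < `|a| + 1 by rewrite ltr_wpDl.
apply: (@bl_antisym _ _ L); apply: bl_le_closed => e e0; last first.
  have [c [cA cb]] := sup_adherent (divr_gt0 e0 an) supA => /ltW; rewrite -/s => sc.
  exists ((s - c) *: a); last first.
    rewrite -{1}(subrK c s) scalerDl addrC; apply: bl_leD => //; exact: bl_refl.
  have cs : c <= s by apply: ub_le_sup => //; exact: supA.2.
  rewrite normrZ ger0_norm ?subr_ge0 //.
  apply: (@le_trans _ _ (e / (`|a| + 1) * `|a|)).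
    by rewrite ler_wpM2r // lerBlDl -lerBlDr.
  by rewrite mulrAC ler_pdivrMr // ler_wpM2l ?(ltW e0)// lerDl.
(* Comparability is only assumed up to the factor 1; if [s = 1], then [b <= a] is the missing
   inequality. *)
have [s1'|s1'] := ltP s 1; last first.
  have -> : s = 1 by apply/eqP; rewrite eq_le s1.
  by exists 0; rewrite ?normr0 ?ltW // scale1r addr0.
pose d := Num.min (1 - s) (e / (`|a| + 1)).
have d0 : 0 < d by rewrite lt_min subr_gt0 s1' divr_gt0.
exists (d *: a).
  rewrite normrZ gtr0_norm //.
  apply: (@le_trans _ _ (e / (`|a| + 1) * `|a|)).
    by rewrite ler_wpM2r // ge_min lexx orbT.
  by rewrite mulrAC ler_pdivrMr // ler_wpM2l ?(ltW e0)// lerDl.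
rewrite -scalerDl; have sd : 0 <= s + d <= 1.
  by rewrite addr_ge0 ?(ltW d0)//= addrC -lerBrDr ge_min lexx.
case: (h _ sd) => // h2.
have : s + d <= s by apply: ub_le_sup; [exact: supA.2|split].
by rewrite gerDl leNgt d0.
Qed.

Section PositiveOperator.
Variable T : E -> E.
Hypothesis TL : forall (a : R) x y, T (a *: x + y) = a *: T x + T y.
Hypothesis T0 : forall x, 0 <=L x -> 0 <=L T x.

Lemma pos_op_mono x y : x <=L y -> T x <=L T y.
Proof.
by move=> /bl_subr_ge0 /T0; rewrite (lin_sub TL) => ?; exact/bl_subr_ge0.
Qed.

Lemma pos_op_abs x : abs (T x) <=L T (abs x).
Proof.
apply: bl_abs_least; first by apply: pos_op_mono; exact: bl_abs_ge.
by rewrite -(lin_opp TL); apply: pos_op_mono; exact: bl_abs_geN.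
Qed.

Lemma pos_op_norm_abs x : `|T x| <= `|T (abs x)|.
Proof. by apply: bl_norm_le_of_abs; exact: pos_op_abs. Qed.

End PositiveOperator.

End BanachLattice.

(** * Operator norm and essential norm *)

Section OperatorNorm.
Variables (R : realType) (E : completeNormedModType R).
Implicit Types T K : E -> E.

Lemma opnorm_le T (M : R) : 0 <= M -> (forall x, `|T x| <= M * `|x|) ->
  opnorm T <= M.
Proof. by move=> M0 h; apply: ge_inf; [exists 0 => m []|split]. Qed.

Lemma opnorm_ge0 T : (exists M : R, forall x, `|T x| <= M * `|x|) ->
  0 <= opnorm T.
Proof.
move=> [M h]; apply: lb_le_inf; last by move=> m [].
exists `|M|; split=> // x; apply: le_trans (h x) _.
by rewrite ler_wpM2r // ler_norm.
Qed.

Lemma opnormP T : (exists M : R, forall x, `|T x| <= M * `|x|) ->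
  forall x, `|T x| <= opnorm T * `|x|.
Proof.
move=> [M h] x; have [x0|x0] := eqVneq `|x| 0.
  by have := h x; rewrite x0 !mulr0.
rewrite -ler_pdivrMr ?lt0r ?x0 //=; apply: lb_le_inf.
  exists `|M|; split=> // y; apply: le_trans (h y) _.
  by rewrite ler_wpM2r // ler_norm.
by move=> m [m0 hm]; rewrite ler_pdivrMr ?lt0r ?x0 //=.
Qed.

Lemma compact_op0 : compact_op (fun _ : E => 0 : E).
Proof.
split; first split.
- by move=> a x y; rewrite scaler0 addr0.
- by exists 0 => x; rewrite normr0 mul0r.
- have -> : (fun=> 0 : E) @` [set x : E | `|x| <= 1] = [set 0].
    apply/seteqP; split=> [_ [x _ <-]//|_ ->]; exists 0 => //=.
    by rewrite normr0.
  have /closure_id <- : closed [set (0 : E)].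
    by apply: compact_closed; [exact: norm_hausdorff|exact: compact_set1].
  exact: compact_set1.
Qed.

Lemma essnorm_lt T (e : R) : bounded_op T -> essnorm T < e ->
  exists2 K, compact_op K & forall x, `|T x - K x| <= e * `|x|.
Proof.
move=> [_ [M hM]]; have bd K : compact_op K ->
    exists N : R, forall x, `|(T \- K) x| <= N * `|x|.
  move=> [[_ [N hN]] _]; exists (M + N) => x /=.
  by rewrite mulrDl; apply: le_trans (ler_normB _ _) _; exact: lerD.
move=> /inf_lt[].
  by exists (opnorm (T \- (fun=> 0))), (fun=> 0) => //; exact: compact_op0.
move=> _ [K cK <-] /ltW le; exists K => // x.
apply: le_trans (opnormP (bd _ cK) x) _.
by rewrite ler_wpM2r.
Qed.

End OperatorNorm.

(** * Limits along a free ultrafilter *)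

Lemma free_ultrafilter : exists U : set_system nat, UltraFilter U /\ \oo `<=` U.
Proof. exact: ultraFilterLemma. Qed.

Section UltraLimits.
Variables (R : realType) (E : completeNormedModType R).
Variable U : set_system nat.
Hypothesis UU : UltraFilter U.
Hypothesis Uoo : \oo `<=` U.

Lemma ultra_near_ge (N : nat) : \forall n \near U, (N <= n)%N.
Proof. exact/Uoo/nbhs_infty_ge. Qed.

Lemma ultra_near_gtr (r : R) : \forall n \near U, r < n%:R.
Proof. exact/Uoo/nbhs_infty_gtr. Qed.

Lemma ultra_fmap (T : Type) (f : nat -> T) : UltraFilter (f @ U).
Proof.
split; first exact: fmap_proper_filter.
move=> G GG sub; apply/seteqP; split=> [A GA|]; last exact: sub.
have [//|/(sub (~` A)) GnA] := in_ultra_setVsetC (f @^-1` A) UU.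
by case: (filter_not_empty G); rewrite -(setICr A); exact: filterI.
Qed.

Lemma lipschitz_cvg (V W : pseudoMetricNormedZmodType R) (f : V -> W) (M : R)
    (y : nat -> V) (l : V) : (forall u v, `|f u - f v| <= M * `|u - v|) ->
  y n @[n --> U] --> l -> f (y n) @[n --> U] --> f l.
Proof.
move=> fM /cvgrPdist_le yl; apply/cvgrPdist_le => e e0.
have M0 : 0 < `|M| + 1 by rewrite ltr_wpDl.
have /yl : 0 < e / (`|M| + 1) by rewrite divr_gt0.
apply: filterS => n; rewrite ler_pdivlMr // => le; apply: le_trans (fM _ _) _.
apply: le_trans le; rewrite mulrC ler_wpM2l //.
by rewrite (le_trans (ler_norm M))// lerDl.
Qed.

Lemma linear_cvg (T : E -> E) (y : nat -> E) l : bounded_op T ->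
  y n @[n --> U] --> l -> T (y n) @[n --> U] --> T l.
Proof.
by move=> [TL [M TM]]; apply: (@lipschitz_cvg _ _ _ M) => u v; rewrite -lin_sub.
Qed.

Lemma dual_cvg (phi : E -> R) (y : nat -> E) l : dual_elt phi ->
  y n @[n --> U] --> l -> phi (y n) @[n --> U] --> phi l.
Proof.
move=> [pL [M pM]]; apply: (@lipschitz_cvg _ _ _ M) => u v.
by rewrite -(@lin_sub _ _ R^o).
Qed.

Lemma ultra_lim_unique (V : pseudoMetricNormedZmodType R) (y : nat -> V) (l l' : V) :
  y n @[n --> U] --> l -> y n @[n --> U] --> l' -> l = l'.
Proof. by apply: cvg_unique; exact: norm_hausdorff. Qed.

Lemma ultra_lim_unique_near (y y' : nat -> E) (l l' : E) :
  y n @[n --> U] --> l -> y' n @[n --> U] --> l' ->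
  (\forall n \near U, y n = y' n) -> l = l'.
Proof.
move=> yl yl' e; apply: (ultra_lim_unique yl).
by apply: cvg_trans yl'; apply: near_eq_cvg; apply: filterS e => n ->.
Qed.

Lemma ultra_lim_norm_le (V : pseudoMetricNormedZmodType R) (y : nat -> V) (l : V) (C : R) :
  y n @[n --> U] --> l -> (\forall n \near U, `|y n| <= C) -> `|l| <= C.
Proof.
move=> /cvgrPdist_le yl yC; apply/ler_addgt0Pr => e e0.
have [n [h1 h2]] := filter_ex (filterI yC (yl _ e0)).
have -> : l = y n + (l - y n) by rewrite addrC subrK.
by apply: le_trans (ler_normD _ _) _; rewrite lerD.
Qed.

(** After rescaling by [D] the values lie in a compact set, where every ultrafilter converges. *)
Lemma compact_op_cvg (K : E -> E) (x : nat -> E) (C : R) : compact_op K ->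
  (\forall n \near U, `|x n| <= C) -> exists z : E, K (x n) @[n --> U] --> z.
Proof.
move=> [[KL [M KM]] Kc] xC.
pose D := `|C| + 1; have D0 : 0 < D by rewrite ltr_wpDl.
have CD : C <= D by rewrite (le_trans (ler_norm C))// lerDl.
pose y n := K (D^-1 *: x n).
have : (y @ U) (closure (K @` [set x : E | `|x| <= 1])).
  apply: filterS xC => n xn; apply: subset_closure; exists (D^-1 *: x n) => //=.
  by rewrite normrZ gtr0_norm ?invr_gt0// ler_pdivrMl // mulr1 (le_trans xn).
have UY := ultra_fmap y.
move: Kc; rewrite compact_ultra => /(_ _ UY) /[apply] -[z [_ yz]].
exists (D *: z); have -> : (fun n => K (x n)) = (fun n => D *: y n).
  by apply/funext => n; rewrite /y (lin_scale KL) scalerA divff ?gt_eqF// scale1r.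
apply: (@lipschitz_cvg _ _ _ D y z _ yz) => u v.
by rewrite -scalerBr normrZ gtr0_norm.
Qed.

(** The image filter is Cauchy. The centre [z] may vary with [e], so an approximation of the
    sequence by convergent ones is enough. *)
Lemma ultra_complete (y : nat -> E) :
  (forall e : R, 0 < e -> exists z, \forall n \near U, `|z - y n| <= e) ->
  exists l : E, y n @[n --> U] --> l.
Proof.
move=> h; suff : cvg (y @ U) by move=> yl; exists (lim (y @ U)).
apply: cauchy_cvg; apply: cauchy_exP => e e0.
have e2 : 0 < e / 2 by rewrite divr_gt0.
have [z hz] := h _ e2; exists z; apply: filterS hz => n zn.
rewrite -ball_normE /ball_ /=; apply: le_lt_trans zn _.
by rewrite ltr_pdivrMr // ltr_pMr // ltrDl.
Qed.

Lemma ultra_bounded_cvg (y : nat -> R) (C : R) :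
  (forall n, `|y n| <= C) -> exists l : R, y n @[n --> U] --> l.
Proof.
move=> yC; have UY := ultra_fmap y.
have := @segment_compact R (- C) C; rewrite compact_ultra => /(_ _ UY).
have Uy : U (y @^-1` `[- C, C]).
  by apply: filterE => n; rewrite /= in_itv /= -ler_norml; exact: yC.
case=> //.
by move=> l [_ yl]; exists l.
Qed.

End UltraLimits.

(** * Growth of the semigroup *)

Section Semigroup.
Variables (R : realType) (E : completeNormedModType R) (S : R -> E -> E).
Hypothesis sgS : semigroup S.

Lemma sg_bounded_op (t : R) : 0 < t -> bounded_op (S t).
Proof. by case: sgS => + _; apply. Qed.

Lemma sg_lin (t : R) : 0 < t ->
  forall (a : R) x y, S t (a *: x + y) = a *: S t x + S t y.
Proof. by case/sg_bounded_op. Qed.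

Lemma sg_add (s t : R) x : 0 < s -> 0 < t -> S (s + t) x = S s (S t x).
Proof. by move=> s0 t0; case: sgS => _ [+ _]; rewrite addrC => ->. Qed.

Lemma sg_comm (s t : R) x : 0 < s -> 0 < t -> S s (S t x) = S t (S s x).
Proof. by move=> s0 t0; rewrite -!sg_add // addrC. Qed.

Lemma sg_opnorm (t : R) x : 0 < t -> `|S t x| <= opnorm (S t) * `|x|.
Proof. by case/sg_bounded_op => _ h; exact: opnormP. Qed.

Lemma sg_sub (s t : R) x : 0 < s -> s < t -> S t x = S s (S (t - s) x).
Proof. by move=> s0 st; rewrite -sg_add ?subr_gt0// addrC subrK. Qed.

Lemma sg_iter (n : nat) x : S n.+1%:R x = iter n.+1 (S 1) x.
Proof.
elim: n => [|n ih] //.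
by rewrite -addn1 natrD addrC sg_add // ih addn1.
Qed.

Hypothesis gbS : growth_bound S = 0%E.

Lemma sg_subexp (d : R) : 0 < d ->
  exists2 M : R, 0 <= M & forall t x, 0 < t -> `|S t x| <= M * expR (d * t) * `|x|.
Proof.
move=> d0; have : (growth_bound S < d%:E)%E by rewrite gbS lte_fin.
move=> /ereal_inf_lt[_ [w [M [M0 hM]] <-]]; rewrite lte_fin => wd.
exists M => // t x t0; apply: le_trans (sg_opnorm _ t0) _.
rewrite ler_wpM2r //; apply: le_trans (hM _ t0) _.
by rewrite ler_wpM2l // ler_expR ler_wpM2r // ltW.
Qed.

(** A contraction factor below 1 at a single time propagates to exponential decay at all times,
    which would make the growth bound negative. *)
Lemma sg_no_decay (t1 q : R) : 0 < t1 -> q < 1 ->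
  ~ forall x, `|S t1 x| <= q * `|x|.
Proof.
move=> t10 q1 hq.
(* [q] may be zero or negative; the maximum with 1/2 makes its logarithm meaningful. *)
have [r [r0 r1 hr]] : exists r : R, [/\ 0 < r, r < 1 & forall x, `|S t1 x| <= r * `|x|].
  exists (Num.max q 2^-1); split.
  - by rewrite lt_max invr_gt0 ltr0n orbT.
  - by rewrite gt_max q1 invf_lt1 // ltr1n.
  - move=> x; apply: le_trans (hq x) _; rewrite ler_wpM2r //.
    by rewrite le_max lexx.
have [M M0 hM] := sg_subexp ltr01.
pose w := ln r / t1.
have w0 : w < 0 by rewrite ltr_pdivrMr // mul0r ln_lt0 // r0.
have ew : expR (w * t1) = r by rewrite divfK ?gt_eqF// lnK.
(* On [(0, t1]] one has [expR (w * t) >= r], so this [C] absorbs the a priori bound [M * expR t1]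
   there. *)
pose C := M * expR t1 / r.
have C0 : 0 <= C by rewrite divr_ge0 ?mulr_ge0 ?expR_ge0 // ltW.
have small t x : 0 < t -> t <= t1 -> `|S t x| <= C * expR (w * t) * `|x|.
  move=> t0 tt1; apply: le_trans (hM _ _ t0) _; rewrite ler_wpM2r //.
  apply: (@le_trans _ _ (M * expR t1)).
    by rewrite mul1r ler_wpM2l // ler_expR.
  have -> : C * expR (w * t) = M * expR t1 * (expR (w * t) / r).
    by rewrite /C; ring.
  rewrite ler_peMr ?mulr_ge0 ?expR_ge0// ler_pdivlMr // mul1r -ew ler_expR.
  by rewrite ler_wnM2l // ltW.
have all (N : nat) t x : 0 < t -> t <= N%:R * t1 ->
    `|S t x| <= C * expR (w * t) * `|x|.
  elim: N t x => [|N ih] t x t0; first by rewrite mul0r leNgt t0.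
  move=> tN; have [tt1|tt1] := leP t t1; first exact: small.
  rewrite (sg_sub _ t10 tt1); apply: le_trans (hr _) _.
  have s0 : 0 < t - t1 by rewrite subr_gt0.
  have sN : t - t1 <= N%:R * t1 by move: tN; rewrite lerBlDr -natr1 mulrDl mul1r.
  apply: le_trans (ler_wpM2l (ltW r0) (ih _ x s0 sN)) _.
  rewrite mulrA ler_wpM2r // -{1}ew mulrCA ler_wpM2l // -expRD -mulrDr.
  by rewrite addrC subrK.
suff : (growth_bound S <= w%:E)%E by rewrite gbS lee_fin leNgt w0.
apply: ereal_inf_lbound; exists w => //; exists C; split=> // t t0.
apply: opnorm_le => [|x]; first by rewrite mulr_ge0 // expR_ge0.
have [N tN] : exists N : nat, t <= N%:R * t1.
  exists (Num.truncn (t / t1)).+1; rewrite -ler_pdivrMr //.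
  by apply/ltW/truncnS_gt.
exact: all tN.
Qed.

Hypothesis acS : asymptotically_compact S.

(** The time is taken to be an integer because invariance is first available only for powers of
    [S 1]. *)
Lemma sg_near_compact (e : R) : 0 < e -> exists2 j : nat, (0 < j)%N &
  exists2 K, compact_op K & forall x, `|S j%:R x - K x| <= e * `|x|.
Proof.
move=> e0; have := @cvgr_lt _ _ _ _ _ _ acS _ e0.
move=> [A [_ hA]].
pose j := (Num.truncn A).+1.
have Aj : A < j%:R by exact: truncnS_gt.
have j0 : 0 < j%:R :> R by rewrite ltr0n.
exists j => //; apply: essnorm_lt; first exact: sg_bounded_op.
exact: hA.
Qed.

Variable U : set_system nat.
Hypothesis UU : UltraFilter U.
Hypothesis Uoo : \oo `<=` U.

(* [z] may depend on [j] but its bound [C] may not: this is what makes the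
   non-compact part of [S j] negligible. *)
Lemma sg_ultra_cvg (y : nat -> E) (C : R) :
  (forall j, (0 < j)%N -> exists z : nat -> E, \forall n \near U,
     `|z n| <= C /\ y n = S j%:R (z n)) ->
  exists l : E, y n @[n --> U] --> l.
Proof.
move=> h; apply: ultra_complete => e e0.
have D0 : 0 < `|C| + 1 by rewrite ltr_wpDl.
have CD : C <= `|C| + 1 by rewrite (le_trans (ler_norm C))// lerDl.
have e2 : 0 < e / 2 by rewrite divr_gt0.
have [j j0 [K cK hK]] := sg_near_compact (divr_gt0 e2 D0).
have [z hz] := h j j0.
have [|w Kw] := @compact_op_cvg _ _ _ UU _ z C cK.
  by apply: filterS hz => n [].
exists w; have /cvgrPdist_le /(_ _ e2) := Kw; apply: filterS2 hz => n [zC ->] hw.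
have -> : w - S j%:R (z n) = (w - K (z n)) - (S j%:R (z n) - K (z n)).
  by rewrite opprB addrA subrK.
apply: le_trans (ler_normB _ _) _; rewrite [leRHS](splitr e) lerD //.
apply: le_trans (hK _) _; rewrite mulrAC ler_pdivrMr // ler_wpM2l ?(ltW e2)//.
exact: le_trans CD.
Qed.

End Semigroup.

(** * An invariant functional and boundedness of the semigroup *)

Section ApproximateInvariance.
Variables (R : realType) (E : completeNormedModType R) (L : banach_lattice E).
Variable T : E -> E.
Hypothesis TL : forall (a : R) x y, T (a *: x + y) = a *: T x + T y.
Hypothesis T0 : forall x, bl_le L 0 x -> bl_le L 0 (T x).
Hypothesis Tsub : forall d : R, 0 < d -> exists2 M : R, 0 <= M &
  forall (n : nat) x, `|iter n T x| <= M * expR (d * n%:R) * `|x|.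
Hypothesis Tnd : forall (n : nat) (q : R), (0 < n)%N -> q < 1 ->
  ~ forall x, `|iter n T x| <= q * `|x|.

Let itL n : forall (a : R) x y, iter n T (a *: x + y) = a *: iter n T x + iter n T y.
Proof. by move=> a x y; elim: n => //= n ->; rewrite TL. Qed.

Let it0 n x : bl_le L 0 x -> bl_le L 0 (iter n T x).
Proof. by move=> x0; elim: n => //= n; exact: T0. Qed.

(** Truncated Neumann series of the inverse of [1 - w T]. *)
Definition abel_sum (w : R) (N : nat) x := \sum_(i < N) w ^+ i *: iter i T x.
Local Notation D := abel_sum.

Let DL w N : forall (a : R) x y, D w N (a *: x + y) = a *: D w N x + D w N y.
Proof.
move=> a x y; rewrite /D scaler_sumr -big_split /=; apply: eq_bigr => i _.
by rewrite itL scalerDr !scalerA mulrC.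
Qed.

Let D0 w N x : 0 <= w -> bl_le L 0 x -> bl_le L 0 (D w N x).
Proof.
move=> w0 x0; apply: bl_sumr_ge0 => i; apply: bl_scaler_ge0; last exact: it0.
exact: exprn_ge0.
Qed.

Let Dbd w N : exists M : R, forall x, `|D w N x| <= M * `|x|.
Proof.
have [M M0 hM] := Tsub ltr01.
exists (\sum_(i < N) `|w| ^+ i * (M * expR (1 * i%:R))) => x.
rewrite mulr_suml; apply: le_trans (ler_norm_sum _ _ _) _; apply: ler_sum => i _.
rewrite normrZ normrX -[leRHS]mulrA ler_wpM2l ?exprn_ge0//; exact: hM.
Qed.

Lemma abel_sum_telescope w N x :
  D w N x - w *: D w N (T x) = x - w ^+ N *: iter N T x.
Proof.
elim: N => [|N ih]; first by rewrite /D !big_ord0 scaler0 expr0 scale1r !subrr.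
rewrite /D !big_ord_recr /= -/(D w N x) -/(D w N (T x)) scalerDr opprD addrACA ih.
by rewrite addrA subrK scalerA -exprS -iterSr.
Qed.

(** There are [n + 1] ways to write [n] as a sum of two exponents, so [(n + 1) T^n] is below the
    square of the partial sum on positive vectors. A uniform bound [C] on the sums would give
    [(n + 1) |T^n| <= C^2] and make some power a strict contraction. *)
Lemma sum_iter_unbounded (C : R) : exists (m : nat) x,
  bl_le L 0 x /\ C * `|x| < `|D 1 m x|.
Proof.
apply: contrapT => h.
have hC m x : bl_le L 0 x -> `|D 1 m x| <= C * `|x|.
  by move=> x0; rewrite leNgt; apply/negP => ?; apply: h; exists m, x.
have le1 n x : bl_le L 0 x -> bl_le L (n.+1%:R *: iter n T x) (D 1 n.+1 (D 1 n.+1 x)).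
  move=> x0; rewrite scaler_nat.
  have -> : iter n T x *+ n.+1 = \sum_(i < n.+1) iter i T (iter (n - i) T x).
    rewrite (eq_bigr (fun=> iter n T x)) ?big_const_ord ?iter_addr_0 // => i _.
    by rewrite -iterD subnKC // -ltnS.
  apply/bl_subr_ge0; rewrite -sumrB; apply: bl_sumr_ge0 => i.
  rewrite expr1n scale1r -(lin_sub (itL _)); apply: it0.
  have lt : (n - i < n.+1)%N by rewrite ltnS leq_subr.
  rewrite /D (bigD1 (Ordinal lt)) //= expr1n scale1r addrAC subrr add0r.
  rewrite -big_filter; apply: bl_sumr_ge0 => k.
  by rewrite expr1n scale1r; exact: it0.
pose n := (Num.truncn (C ^+ 2)).+1.
have Cn : C ^+ 2 < n.+1%:R by apply: lt_trans (truncnS_gt _) _; rewrite ltr_nat.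
have n0 : (0 < n.+1%:R :> R) by [].
apply: (@Tnd n (C ^+ 2 / n.+1%:R)) => //; first by rewrite ltr_pdivrMr // mul1r.
move=> x; apply: le_trans (pos_op_norm_abs (itL n) (@it0 n) x) _.
rewrite -(bl_norm_abs L x); have := bl_abs_ge0 L x; move: (bl_abs L x) => {}x x0.
rewrite mulrAC ler_pdivlMr // mulrC -[n.+1%:R]gtr0_norm // -normrZ.
have nx : bl_le L 0 (n.+1%:R *: iter n T x) by apply: bl_scaler_ge0 => //; exact: it0.
apply: le_trans (bl_norm_le nx (le1 n x x0)) _.
have Dx : bl_le L 0 (D 1 n.+1 x) by exact: D0.
apply: le_trans (hC _ _ Dx) _; have [C0|C0] := leP 0 C.
  by rewrite expr2 -mulrA ler_wpM2l // hC.
apply: (@le_trans _ _ 0); first by rewrite mulr_le0_ge0 // ltW.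
by rewrite mulr_ge0 // sqr_ge0.
Qed.

(** [A] is the truncated Abel sum [B] divided by its norm [a]. Telescoping bounds [B - B T] by
    [2 + (e / 2) a], which is at most [e a] as soon as [a > 4 / e]. *)
Lemma approx_invariant_op (e : R) : 0 < e -> exists A : E -> E,
  [/\ forall (a : R) x y, A (a *: x + y) = a *: A x + A y,
      forall x, bl_le L 0 x -> bl_le L 0 (A x),
      forall x, `|A x| <= `|x|,
      forall x, `|A x - A (T x)| <= e * `|x|
    & exists x, [/\ bl_le L 0 x, `|x| <= 1 & 2^-1 <= `|A x|]].
Proof.
move=> e0; have [M1 M10 hM1] := Tsub ltr01.
pose tau := M1 * expR 1; have tau0 : 0 <= tau by rewrite mulr_ge0 ?expR_ge0.
have hT x : `|T x| <= tau * `|x| by have := hM1 1 x; rewrite mulr1.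
(* The extra factor 2 pays for the weights [w ^+ i], which stay above 1/2 for [i < m]. *)
have [m [x0 [x00 hx0]]] := sum_iter_unbounded (2 * (4 / e)).
(* [d] is small enough for two purposes: [w ^+ m >= 1/2] and [(1 - w) tau <= e / 2], where
   [w = expR (- (2 * d))]. *)
pose d := (4 * (m%:R + tau / e + 1))^-1.
have den : 0 < m%:R + tau / e + 1 by rewrite ltr_wpDl // addr_ge0 // divr_ge0 // ltW.
have d0 : 0 < d by rewrite invr_gt0 mulr_gt0.
have d4 : 4 * d = (m%:R + tau / e + 1)^-1 by rewrite /d invfM mulrA divff // mul1r.
have dm : 4 * d * m%:R <= 1.
  rewrite d4 mulrC ler_pdivrMr // mul1r -addrA lerDl.
  by rewrite addr_ge0 // divr_ge0 // ltW.
have dtau : 2 * d * tau <= e / 2.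
  have : 4 * d * (tau / e) <= 1.
    rewrite d4 mulrC ler_pdivrMr // mul1r.
    by rewrite addrAC lerDr addr_ge0.
  rewrite mulrA ler_pdivrMr // mul1r => h.
  rewrite ler_pdivlMr //; apply: le_trans h.
  by have -> : 2 * d * tau * 2 = 4 * d * tau by ring.
pose w := expR (- (2 * d)).
have w0 : 0 < w by exact: expR_gt0.
have w1 : w <= 1 by rewrite -expR0 ler_expR oppr_le0 mulr_ge0 // ltW.
have w2d : 1 - w <= 2 * d.
  by rewrite lerBlDr -lerBlDl; have := expR_ge1Dx (- (2 * d)).
have wm : 2^-1 <= w ^+ m.
  rewrite -expRM_natl; apply: le_trans (expR_ge1Dx _).
  by move: dm; set mm := m%:R => dm; lra.
(* [T^n] grows at most like [expR (d * n)] while [w ^+ n] decays at twice that rate. Hence the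
   remainder [w^N T^N] is a contraction once [M <= d * N]. *)
have [M M0 hM] := Tsub d0.
pose N := maxn m (Num.truncn (M / d)).+1.
have mN : (m <= N)%N by exact: leq_maxl.
have wN x : `|w ^+ N *: iter N T x| <= `|x|.
  rewrite normrZ gtr0_norm ?exprn_gt0 // -expRM_natl.
  apply: le_trans (ler_wpM2l (expR_ge0 _) (hM N x)) _.
  rewrite mulrA ler_piMl //.
  have -> : expR (N%:R * - (2 * d)) * (M * expR (d * N%:R)) = M * expR (- (d * N%:R)).
    by rewrite mulrCA -expRD; congr (_ * expR _); ring.
  rewrite expRN ler_pdivrMr ?expR_gt0 // mul1r; apply: le_trans (expR_ge1Dx _).
  rewrite -lerBlDl; apply: (@le_trans _ _ M); first by rewrite lerBlDl lerDr.
  rewrite mulrC -ler_pdivrMr //; apply: le_trans (ltW (truncnS_gt _)) _.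
  by rewrite ler_nat leq_maxr.
pose B := D w N; pose a := opnorm B.
have Ba x : `|B x| <= a * `|x| by apply: opnormP; exact: Dbd.
have a_ge : 4 / e < a.
  have x0n : 0 < `|x0|.
    rewrite lt0r normr_ge0 andbT; apply/eqP => h.
    by move: hx0; rewrite (normr0_eq0 h) (lin_zero (DL _ _)) normr0 mulr0 ltxx.
  rewrite -(ltr_pM2r x0n); apply: lt_le_trans (Ba x0).
  have : `|2^-1 *: D 1 m x0| <= `|B x0|.
    apply: (@bl_norm_le _ _ L); first by apply: bl_scaler_ge0 => //; exact: D0.
    apply/bl_subr_ge0; rewrite /B /D scaler_sumr.
    rewrite (big_ord_widen _ (fun i => 2^-1 *: (1 ^+ i *: iter i T x0)) mN).
    rewrite [X in _ - X]big_mkcond -sumrB; apply: bl_sumr_ge0 => i /=.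
    have ix := it0 i x00.
    case: ifPn => im; last first.
      by rewrite subr0; apply: bl_scaler_ge0 => //; exact/exprn_ge0/ltW.
    rewrite expr1n scale1r -scalerBl; apply: bl_scaler_ge0 => //.
    rewrite subr_ge0; apply: le_trans wm _.
    by apply: ler_wiXn2l; [exact: ltW|exact: w1|exact: ltnW].
  rewrite normrZ gtr0_norm // => h; apply: lt_le_trans h.
  by rewrite ltr_pdivlMl // mulrA.
have a0 : 0 < a by apply: lt_trans a_ge; rewrite divr_gt0.
exists (fun x => a^-1 *: B x); split.
- by move=> b x y; rewrite /B DL scalerDr !scalerA mulrC.
- move=> x xx; apply: bl_scaler_ge0; first by rewrite invr_ge0 ltW.
  by apply: D0 => //; exact: ltW.
- by move=> x; rewrite normrZ gtr0_norm ?invr_gt0 // ler_pdivrMl.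
- move=> x; rewrite -scalerBr normrZ gtr0_norm ?invr_gt0 // ler_pdivrMl //.
  have -> : B x - B (T x) = (x - w ^+ N *: iter N T x) - (1 - w) *: B (T x).
    by rewrite -abel_sum_telescope scalerBl scale1r opprB addrA subrK.
  apply: le_trans (ler_normB _ _) _.
  have h1 : `|x - w ^+ N *: iter N T x| <= 2 * `|x|.
    by apply: le_trans (ler_normB _ _) _; rewrite mulr_natl mulr2n lerD.
  have h2 : `|(1 - w) *: B (T x)| <= e / 2 * a * `|x|.
    rewrite normrZ ger0_norm ?subr_ge0 //.
    apply: (@le_trans _ _ (2 * d * (a * (tau * `|x|)))).
      apply: ler_pM => //; first by rewrite subr_ge0.
      by apply: le_trans (Ba _) _; rewrite ler_wpM2l // ltW.
    have -> : 2 * d * (a * (tau * `|x|)) = (2 * d * tau) * (a * `|x|) by ring.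
    by rewrite -[leRHS]mulrA ler_wpM2r // mulr_ge0 // ltW.
  apply: le_trans (lerD h1 h2) _; rewrite -mulrDl mulrA ler_wpM2r //.
  move: a_ge; rewrite ltr_pdivrMr // => a_ge; lra.
(* A vector nearly attaining the norm of [B] may be replaced by its absolute value, since [B] is
   positive. *)
- have [x hx] : exists x, a / 2 * `|x| < `|B x|.
    apply: contrapT => h; have : a <= a / 2.
      apply: opnorm_le; first by rewrite divr_ge0 // ltW.
      by move=> x; rewrite leNgt; apply/negP => ?; apply: h; exists x.
    by rewrite leNgt ltr_pdivrMr // ltr_pMr // ltrDl ltr01.
  have xn : 0 < `|x|.
    rewrite lt0r normr_ge0 andbT; apply/eqP => h.
    by move: hx; rewrite (normr0_eq0 h) /B (lin_zero (DL _ _)) normr0 mulr0 ltxx.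
  exists (`|x|^-1 *: bl_abs L x); split.
  + by apply: bl_scaler_ge0; [rewrite invr_ge0|exact: bl_abs_ge0].
  + by rewrite normrZ gtr0_norm ?invr_gt0 // bl_norm_abs mulVf ?gt_eqF.
  + rewrite /B (lin_scale (DL _ _)) !normrZ !gtr0_norm ?invr_gt0 //.
    rewrite ler_pdivlMl // ler_pdivlMl // mulrC.
    apply: le_trans (ltW hx) (pos_op_norm_abs (L := L) (DL w N) _ x).
    by move=> y y0; apply: D0 => //; exact: ltW.
Qed.

End ApproximateInvariance.

(** * Invariant functional from approximate invariance *)

Section InvariantFunctional.
Variables (R : realType) (E : completeNormedModType R) (L : banach_lattice E).
Variable S : R -> E -> E.
Hypothesis sgS : semigroup S.
Hypothesis posS : positive_sg L S.
Hypothesis gbS : growth_bound S = 0%E.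
Hypothesis acS : asymptotically_compact S.

Let sgL t (t0 : 0 < t) := sg_lin sgS t0.

Lemma sg_approx_invariant (e : R) : 0 < e -> exists A : E -> E,
  [/\ forall (a : R) x y, A (a *: x + y) = a *: A x + A y,
      forall x, bl_le L 0 x -> bl_le L 0 (A x),
      forall x, `|A x| <= `|x|,
      forall x, `|A x - A (S 1 x)| <= e * `|x|
    & exists x, [/\ bl_le L 0 x, `|x| <= 1 & 2^-1 <= `|A x|]].
Proof.
apply: approx_invariant_op.
- exact: sgL.
- exact: posS.
(* The summand 1 covers [n = 0], where the iterate is the identity and no value of [S] is
   involved. *)
- move=> d d0; have [M M0 hM] := sg_subexp sgS gbS d0; exists (M + 1) => [|n x].
    by rewrite addr_ge0.
  have le1 : 1 <= expR (d * n%:R) by rewrite -expR0 ler_expR mulr_ge0 // ltW.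
  case: n le1 => [|n] le1.
    by rewrite ler_peMl // mulr_ege1 // lerDr.
  rewrite -sg_iter //; apply: le_trans (hM _ _ _) _ => //.
  by rewrite ler_wpM2r // ler_wpM2r ?expR_ge0 // lerDl.
- move=> [//|n] q _ q1 h; apply: (@sg_no_decay _ _ _ sgS gbS n.+1%:R q) => // x.
  by rewrite sg_iter.
Qed.

(** Telescoping over [j] steps. [B] depends on [j] alone, so the error vanishes along operators [A]
    with [e] tending to 0. *)
Lemma sg_approx_invariant_iter (j : nat) : (0 < j)%N -> exists2 B : R, 0 <= B &
  forall (A : E -> E) (e : R), 0 <= e -> (forall x, `|A x - A (S 1 x)| <= e * `|x|) ->
    forall x, `|A x - A (S j%:R x)| <= e * B * `|x|.
Proof.
elim: j => // -[_ _|j ih _]; first by exists 1 => // A e _ h x; rewrite mulr1.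
have [//|B B0 hB] := ih; have n1 := opnorm_ge0 (sg_bounded_op sgS ltr01).2.
exists (1 + B * opnorm (S 1)); first by rewrite addr_ge0 // mulr_ge0.
move=> A e e0 h x; rewrite -[j.+2]addn1 natrD sg_add //.
have -> : A x - A (S j.+1%:R (S 1 x)) =
    (A x - A (S 1 x)) + (A (S 1 x) - A (S j.+1%:R (S 1 x))) by rewrite addrA subrK.
apply: le_trans (ler_normD _ _) _; rewrite mulrDr mulr1 mulrDl lerD //.
apply: le_trans (hB A e e0 h _) _; rewrite mulrA -[leRHS]mulrA.
by rewrite ler_wpM2l ?mulr_ge0 //; exact: sg_opnorm.
Qed.

(* A functional dominated by lim_k |(A_k x)^+| is automatically invariant; asymptotic
   compactness only serves to show that this bound does not vanish. *)
Lemma invariant_functional : exists phi : E -> R,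
  spos_functional L phi /\ forall x, phi (S 1 x) = phi x.
Proof.
have [U [UU Uoo]] := free_ultrafilter.
have /choice[A hA] (k : nat) :=
  @sg_approx_invariant k.+1%:R^-1 (ltac:(by rewrite invr_gt0)).
have AL k := let: And5 h _ _ _ _ := hA k in h.
have A0 k := let: And5 _ h _ _ _ := hA k in h.
have A1 k := let: And5 _ _ h _ _ := hA k in h.
have AT k := let: And5 _ _ _ h _ := hA k in h.
have /choice[X hX] k := let: And5 _ _ _ _ h := hA k in h.
pose g x k := `|bl_pp L (A k x)|.
have g1 x k : g x k <= `|x| by apply: le_trans (bl_norm_pp _ _) _.
have /choice[p pP] x : exists l : R, g x k @[k --> U] --> l.
  by apply: (@ultra_bounded_cvg _ _ UU (g x) `|x|) => k; rewrite /g normr_id; exact: g1.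
have p_le x c : (forall e : R, 0 < e -> \forall k \near U, g x k <= c + e) -> p x <= c.
  move=> h; apply/ler_addgt0Pr => e e0.
  have e2 : 0 < e / 2 by rewrite divr_gt0.
  have /cvgrPdist_le /(_ _ e2) := pP x => h2.
  have [k [h3 h4]] := filter_ex (filterI (h _ e2) h2).
  by move: h4; rewrite ler_distlC => /andP[h4 h5]; lra.
have p_norm x : p x <= `|x|.
  by apply: p_le => e e0; apply: filterE => k; rewrite (le_trans (g1 x k))// lerDl ltW.
have sp : sublinear p.
  split=> [a x a0|x y].
    apply: (ultra_lim_unique UU (pP _)).
    have -> : g (a *: x) = (fun k => a * g x k).
      apply/funext => k; rewrite /g (lin_scale (AL k)) bl_ppZ //.
      by rewrite normrZ ger0_norm.
    apply: (@lipschitz_cvg _ _ UU R R ( *%R a) `|a| (g x)) (pP x) => u v.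
    by rewrite -mulrBr normrM.
  apply: ler_cvg_to (pP _) (cvgD (pP x) (pP y)) _; apply: filterE => k.
  rewrite /g /= (lin_add (AL k)); apply: le_trans _ (ler_normD _ _).
  by apply: (bl_norm_le (bl_pp_ge0 _ _)); exact: bl_ppD.
(* The norm of [A k (X k)] is at least 1/2; three errors of size 1/16 still leave more than 1/4 for
   [A k z]. *)
have [j j0 [K cK hK]] : exists2 j : nat, (0 < j)%N &
    exists2 K, compact_op K & forall x, `|S j%:R x - K x| <= 16^-1 * `|x|.
  by apply: (sg_near_compact sgS acS); rewrite invr_gt0.
have [z Kz] : exists z : E, K (X k) @[k --> U] --> z.
  apply: (@compact_op_cvg _ _ _ UU _ X 1 cK); apply: filterE => k.
  by case: (hX k).
have [B B0 hB] := sg_approx_invariant_iter j0.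
(* As [A k v] is positive, [g v k] is its full norm and dominates that of [A k z]. *)
pose v := bl_abs L z.
have pv : 0 < p v.
  apply: (@lt_le_trans _ _ 4^-1); first by rewrite invr_gt0.
  rewrite leNgt; apply/negP => pv.
  have e16 : (0 : R) < 16^-1 by rewrite invr_gt0.
  have /cvgrPdist_lt /(_ (4^-1 - p v)) := pP v; rewrite subr_gt0 => /(_ pv) h1.
  have /cvgrPdist_le /(_ _ e16) h2 := Kz.
  have h3 := ultra_near_gtr Uoo (16 * B).
  have [k [gv [zk kB]]] := filter_ex (filterI h1 (filterI h2 h3)).
  move: gv; rewrite ltr_distlC => /andP[_ gv].
  have {gv} gv : g v k < 4^-1 by move: gv; rewrite addrC subrK.
  case: (hX k) => x0 x1 Ax.
  have Az : `|A k z| <= g v k.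
    rewrite /g bl_pp_id; last exact/A0/bl_abs_ge0.
    exact: pos_op_norm_abs (AL k) (A0 k) z.
  have b1 : `|A k (X k) - A k (S j%:R (X k))| <= 16^-1.
    apply: le_trans (hB _ _ _ (AT k) _) _ => //.
    apply: (@le_trans _ _ (k.+1%:R^-1 * B)).
      by rewrite ler_piMr // mulr_ge0.
    rewrite ler_pdivrMl //; have : k%:R < k.+1%:R :> R by rewrite ltr_nat.
    by move: kB; set u := k%:R; set w := k.+1%:R => *; lra.
  have b2 : `|A k (S j%:R (X k) - K (X k))| <= 16^-1.
    apply: le_trans (A1 _ _) _; apply: le_trans (hK _) _.
    by rewrite ler_piMr // ltW.
  have b3 : `|A k (z - K (X k))| <= 16^-1 by apply: le_trans (A1 _ _) _.
  have : `|A k (X k)| <= `|A k z| + 16^-1 + 16^-1 + 16^-1.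
    have {1}-> : A k (X k) = A k z - A k (z - K (X k)) + A k (S j%:R (X k) - K (X k))
        + (A k (X k) - A k (S j%:R (X k))).
      rewrite !(lin_sub (AL k)) subKr [A k (K _) + _]addrC subrK.
      by rewrite addrC subrK.
    apply: le_trans (ler_normD _ _) _; apply: lerD => //.
    apply: le_trans (ler_normD _ _) _; apply: lerD => //.
    by apply: le_trans (ler_normB _ _) _; apply: lerD.
  lra.
have [phi [phiL phip phiv]] := hahn_banach v sp.
have phiN x : phi (- x) = - phi x by rewrite (@lin_opp _ _ R^o).
have phi_bd x : `|phi x| <= `|x|.
  rewrite ler_norml lerNl -phiN; apply/andP; split; apply: le_trans (phip _) _ => //.
  by rewrite -(normrN x).
exists phi; split; first split.
- by split=> //; exists 1 => x; rewrite mul1r.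
- split=> [f f0|]; last by exists v; apply/eqP; rewrite gt_eqF // phiv.
  rewrite -oppr_le0 -phiN; apply: le_trans (phip _) _; apply: p_le => e e0.
  apply: filterE => k; rewrite /g bl_pp_eq0 ?normr0 ?add0r ?ltW //.
  by rewrite (lin_opp (AL k)) -[0]oppr0; apply: bl_leN; exact: A0.
(* The bound [p (x - S 1 x)] is at most the limit of [|x| / (k + 1)], that is 0; using [- x] as well
   turns the inequality into equality. *)
- have h x : phi x - phi (S 1 x) <= 0.
    rewrite -(@lin_sub _ _ R^o _ phiL); apply: le_trans (phip _) _.
    apply: p_le => e e0; have := ultra_near_gtr Uoo (`|x| / e).
    apply: filterS => k; rewrite ltr_pdivrMr // => xk; rewrite add0r.
    apply: le_trans (bl_norm_pp _ _) _; rewrite (lin_sub (AL k)).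
    apply: le_trans (AT k x) _; rewrite ler_pdivrMl //; apply: le_trans (ltW xk) _.
    by rewrite ler_wpM2r ?(ltW e0)// ler_nat.
  move=> x; have hx := h x; have := h (- x).
  rewrite (lin_opp (sgL ltr01)) !phiN opprK => hN.
  by apply/eqP; rewrite eq_le; apply/andP; split; lra.
Qed.

End InvariantFunctional.

(** * Boundedness of the semigroup *)

Section Boundedness.
Variables (R : realType) (E : completeNormedModType R) (L : banach_lattice E).
Variable S : R -> E -> E.
Hypothesis sgS : semigroup S.
Hypothesis posS : positive_sg L S.
Hypothesis irrS : irreducible_sg L S.
Hypothesis gbS : growth_bound S = 0%E.
Hypothesis acS : asymptotically_compact S.
Variable phi : E -> R.
Hypothesis phi0 : spos_functional L phi.
Hypothesis phi1 : forall x, phi (S 1 x) = phi x.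

Lemma invariant_nat (n : nat) x : (0 < n)%N -> phi (S n%:R x) = phi x.
Proof.
elim: n x => // -[_ x _|n ih x _]; first exact: phi1.
by rewrite -[n.+2]addn1 natrD sg_add // ih.
Qed.

Lemma invariant_dual (s : R) : 0 < s -> dual_elt (fun x => phi (S s x)).
Proof.
move=> s0; case: phi0 => [[pL [M hM]] _]; split.
  by move=> a x y; rewrite (sg_lin sgS s0) pL.
exists (`|M| * opnorm (S s)) => x; apply: le_trans (hM _) _.
apply: (@le_trans _ _ (`|M| * `|S s x|)); first by rewrite ler_wpM2r // ler_norm.
by rewrite -mulrA ler_wpM2l //; exact: sg_opnorm.
Qed.

(** The form of irreducibility that can be used while [phi] is only known to be invariant under
    [S 1]. *)
Lemma irreducible_eq0 x : bl_le L 0 x ->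
  (forall s, 0 < s -> phi (S s x) <= 0) -> x = 0.
Proof.
move=> x0 h; apply: contrapT => xn.
have [s [s0]] := irrS (conj x0 xn) phi0.
by rewrite ltNge h.
Qed.

(* Normalised images at record times of |S n| accumulate at a positive vector of norm at
   least 1/2 on which every [phi \o S s] vanishes. *)
Lemma sg_nat_bounded : exists M : R, forall n : nat, opnorm (S n.+1%:R) <= M.
Proof.
apply: contrapT => nb; pose c (n : nat) := opnorm (S n.+1%:R).
have cP n x : `|S n.+1%:R x| <= c n * `|x| by exact: sg_opnorm.
have exn (k : nat) : exists n, k%:R < c n.
  apply: contrapT => h; apply: nb; exists k%:R => n; rewrite leNgt.
  by apply/negP => ?; apply: h; exists n.
(* The first index whose norm exceeds [k]: all earlier norms are at most [k], hence smaller than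
   [c (r k)]. *)
pose r k := ex_minn (exn k).
have rP k : k%:R < c (r k) by rewrite /r; case: ex_minnP.
have rmin k i : (i < r k)%N -> c i <= k%:R.
  rewrite /r; case: ex_minnP => m _ mmin im; rewrite leNgt; apply/negP => /mmin.
  by rewrite leqNgt im.
have c0 k : 0 < c (r k) by apply: le_lt_trans (rP k).
have /choice[X hX] (k : nat) : exists x, [/\ bl_le L 0 x, `|x| <= 1
    & c (r k) / 2 <= `|S (r k).+1%:R x|].
  have [x hx] : exists x, c (r k) / 2 * `|x| < `|S (r k).+1%:R x|.
    apply: contrapT => h; have : c (r k) <= c (r k) / 2.
      apply: opnorm_le; first by rewrite divr_ge0 // ltW.
      by move=> x; rewrite leNgt; apply/negP => ?; apply: h; exists x.
    by rewrite leNgt ltr_pdivrMr // ltr_pMr // ltrDl ltr01.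
  have sl := sg_lin sgS (ltr0Sn R (r k)).
  have xn : 0 < `|x|.
    rewrite lt0r normr_ge0 andbT; apply/eqP => h.
    by move: hx; rewrite (normr0_eq0 h) (lin_zero sl) normr0 mulr0 ltxx.
  exists (`|x|^-1 *: bl_abs L x); split.
  - by apply: bl_scaler_ge0; [rewrite invr_ge0|exact: bl_abs_ge0].
  - by rewrite normrZ gtr0_norm ?invr_gt0 // bl_norm_abs mulVf ?gt_eqF.
  - rewrite (lin_scale sl) normrZ gtr0_norm ?invr_gt0 // ler_pdivlMl // mulrC.
    by apply: le_trans (ltW hx) (pos_op_norm_abs (L := L) sl _ x); exact: posS.
have [U [UU Uoo]] := free_ultrafilter.
pose y k := (c (r k))^-1 *: S (r k).+1%:R (X k).
have [l yl] : exists l : E, y k @[k --> U] --> l.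
  apply: (@sg_ultra_cvg _ _ _ sgS acS _ UU y 1) => j j0.
  (* Going back [j] steps from a record time leads to a smaller norm, so these preimages have norm
     at most 1. Records eventually lie beyond [j], because the first [j] norms are bounded. *)
  exists (fun k => (c (r k))^-1 *: S (r k - j).+1%:R (X k)).
  have [b hb] : exists b : nat, forall i, (i < j)%N -> c i <= b%:R.
    exists (Num.truncn (\sum_(i < j) `|c i|)).+1 => i ij.
    apply: le_trans (ltW (truncnS_gt _)).
    rewrite (bigD1 (Ordinal ij)) //=; apply: le_trans (ler_norm _) _.
    by rewrite lerDl sumr_ge0.
  have := ultra_near_ge Uoo b; apply: filterS => k bk.
  have jr : (j <= r k)%N.
    rewrite leqNgt; apply/negP => /hb; rewrite leNgt => /negP; apply.
    by apply: le_lt_trans (rP k); rewrite ler_nat.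
  split.
    rewrite normrZ gtr0_norm ?invr_gt0 // ler_pdivrMl // mulr1.
    apply: le_trans (cP _ _) _; case: (hX k) => _ x1 _.
    have ci : c (r k - j)%N <= c (r k).
      apply: le_trans (ltW (rP k)); apply: rmin.
      by rewrite ltn_subrL j0 (leq_trans j0).
    have ci0 : 0 <= c (r k - j)%N by apply: opnorm_ge0; exact: (sg_bounded_op sgS _).2.
    by rewrite -[leRHS]mulr1; apply: ler_pM.
  rewrite (lin_scale (sg_lin sgS _)) ?ltr0n // -sg_add ?ltr0n // -natrD.
  by rewrite addnS subnKC.
have y_ge k : 2^-1 <= `|y k|.
  rewrite normrZ gtr0_norm ?invr_gt0 // ler_pdivlMl //.
  by case: (hX k).
have l0 : bl_le L 0 l.
  apply: bl_ge0_closed => e e0; have /cvgrPdist_le /(_ _ e0) := yl.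
  case/filter_ex => k hk; exists (y k) => //; apply: bl_scaler_ge0.
    by rewrite invr_ge0 ltW.
  by apply: posS => //; case: (hX k).
suff lz : l = 0.
  have e4 : (0 : R) < 4^-1 by rewrite invr_gt0.
  have /cvgrPdist_le /(_ _ e4) := yl; case/filter_ex => k.
  by rewrite lz sub0r normrN => hk; have := y_ge k; lra.
apply: irreducible_eq0 l0 _ => s s0.
have ds := invariant_dual s0; have := dual_cvg UU ds yl => cv.
apply: le_trans (ler_norm _) _; apply/ler_addgt0Pr => e e0; rewrite add0r.
apply: (ultra_lim_norm_le UU cv).
case: (ds) => dL [M hM]; have := ultra_near_gtr Uoo (`|M| / e).
apply: filterS => k; rewrite ltr_pdivrMr // => Mk.
rewrite /y (@lin_scale _ _ R^o _ dL) normrZ gtr0_norm ?invr_gt0 // ler_pdivrMl //.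
(* Commuting [S s] to the inside lets [phi] absorb the large integer time; what remains is bounded
   and is divided by [c (r k)], which exceeds [k]. *)
rewrite sg_comm ?ltr0n // invariant_nat //; apply: le_trans (hM _) _.
case: (hX k) => _ x1 _; apply: (@le_trans _ _ `|M|).
  by apply: le_trans (ler_wpM2r _ (ler_norm M)) _ => //; rewrite ler_piMr.
by apply: le_trans (ltW Mk) _; rewrite ler_wpM2r ?ltW.
Qed.

Lemma sg_bounded : exists2 M : R, 0 <= M & forall t x, 0 < t -> `|S t x| <= M * `|x|.
Proof.
have [M hM] := sg_nat_bounded; have [C C0 hC] := sg_subexp sgS gbS ltr01.
have D0 : 0 <= C * expR 2 by rewrite mulr_ge0 ?expR_ge0.
have small t x : 0 < t -> t <= 2 -> `|S t x| <= C * expR 2 * `|x|.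
  move=> t0 t2; apply: le_trans (hC _ _ t0) _; rewrite ler_wpM2r //.
  by rewrite mul1r ler_wpM2l // ler_expR.
exists ((`|M| + 1) * (C * expR 2)); first by rewrite mulr_ge0 // addr_ge0.
move=> t x t0; have [t2|t2] := leP t 2.
  apply: le_trans (small _ _ t0 t2) _; rewrite ler_wpM2r // ler_peMl //.
  by rewrite lerDr.
(* Splitting off the integer part of [t] minus one leaves a remainder in [[1, 2)], which is never 0,
   as the semigroup law requires. *)
pose n := (Num.truncn t).-2.
have nE : n.+2 = Num.truncn t.
  have : (2 <= Num.truncn t)%N by rewrite truncn_ge_nat // ltW.
  by rewrite /n; case: (Num.truncn t) => [|[|k]].
have /andP[nt tn] : n.+2%:R <= t < n.+3%:R.
  by rewrite nE truncn_itv // ltW.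
have lt1 : n.+1%:R < t by apply: lt_le_trans nt; rewrite ltr_nat.
rewrite (sg_sub sgS _ (ltr0Sn R n) lt1); apply: le_trans (sg_opnorm sgS _ _) _ => //.
apply: (@le_trans _ _ ((`|M| + 1) * `|S (t - n.+1%:R) x|)).
  rewrite ler_wpM2r //; apply: le_trans (hM n) _; apply: le_trans (ler_norm _) _.
  by rewrite lerDl.
rewrite -mulrA ler_wpM2l ?addr_ge0 //; apply: small; first by rewrite subr_gt0.
by rewrite lerBlDr -natrD addSn add1n ltW.
Qed.

End Boundedness.

(** * Reversible vectors *)

Section Reversible.
Variables (R : realType) (E : completeNormedModType R).
Variable S : R -> E -> E.
Hypothesis sgS : semigroup S.
Hypothesis acS : asymptotically_compact S.
Variable M : R.
Hypothesis M0 : 0 <= M.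
Hypothesis SM : forall t x, 0 < t -> `|S t x| <= M * `|x|.
Variable U : set_system nat.
Hypothesis UU : UltraFilter U.
Hypothesis Uoo : \oo `<=` U.

(** One bound [C] serves all times, whereas preimages at different times need not be related. This
    is the analogue of the reversible part in a Jacobs-de Leeuw-Glicksberg splitting. *)
Definition reversible (g : E) := exists C : R,
  forall t, 0 < t -> exists2 h, `|h| <= C & S t h = g.

(** For each [j], the vector [S (t n) (x n)] is eventually the image under [S j] of one with norm at
    most [M * C]. *)
Lemma sg_orbit_cvg (t : nat -> R) (x : nat -> E) (C : R) :
  (forall A, \forall n \near U, A < t n) -> (\forall n \near U, `|x n| <= C) ->
  exists l : E, S (t n) (x n) @[n --> U] --> l.
Proof.
move=> ht hx; apply: (@sg_ultra_cvg _ _ _ sgS acS _ UU _ (M * C)) => j j0.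
exists (fun n => S (t n - j%:R) (x n)).
apply: filterS2 hx (ht j%:R) => n xn tj; split.
  by apply: le_trans (SM _ _) _; rewrite ?subr_gt0 // ler_wpM2l.
by rewrite -(sg_sub sgS) // ltr0n.
Qed.

(** A preimage of the limit under [S s] is the limit of the same vectors at times [t n - s]. *)
Lemma sg_orbit_lim_reversible (t : nat -> R) (x : nat -> E) (C : R) (l : E) :
  (forall A, \forall n \near U, A < t n) -> (\forall n \near U, `|x n| <= C) ->
  S (t n) (x n) @[n --> U] --> l -> reversible l.
Proof.
move=> ht hx yl; exists (M * C) => s s0.
have hts A : \forall n \near U, A < t n - s.
  by apply: filterS (ht (A + s)) => n; rewrite ltrBrDr.
have [h zh] := sg_orbit_cvg hts hx; exists h.
  apply: (ultra_lim_norm_le UU zh); apply: filterS2 hx (hts 0) => n xn ts.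
  by apply: le_trans (SM _ _) _ => //; rewrite ler_wpM2l.
apply: (ultra_lim_unique_near UU (linear_cvg UU (sg_bounded_op sgS s0) zh) yl).
by apply: filterS (ht s) => n ts; rewrite -(sg_sub sgS).
Qed.

Lemma reversible_lin (a : R) g h : reversible g -> reversible h ->
  reversible (a *: g + h).
Proof.
move=> [C hC] [D hD]; exists (`|a| * C + D) => t t0.
have [u uC <-] := hC t t0; have [v vD <-] := hD t t0.
exists (a *: u + v); last by rewrite (sg_lin sgS t0).
by apply: le_trans (ler_normD _ _) _; rewrite lerD // normrZ ler_wpM2l.
Qed.

Lemma reversible0 : reversible 0.
Proof.
by exists 0 => t t0; exists 0; rewrite ?normr0 // (lin_zero (sg_lin sgS t0)).
Qed.

Lemma reversibleD g h : reversible g -> reversible h -> reversible (g + h).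
Proof. by move=> rg rh; rewrite -[g]scale1r; exact: reversible_lin. Qed.

Lemma reversibleZ (a : R) g : reversible g -> reversible (a *: g).
Proof.
move=> rg; rewrite -[_ *: _]addr0; apply: reversible_lin => //.
exact: reversible0.
Qed.

Lemma reversibleB g h : reversible g -> reversible h -> reversible (g - h).
Proof. by move=> rg rh; rewrite addrC -scaleN1r; exact: reversible_lin. Qed.

Lemma reversible_sg (s : R) g : 0 < s -> reversible g -> reversible (S s g).
Proof.
move=> s0 [C hC]; exists (M * C) => t t0; have [h hC' <-] := hC t t0.
exists (S s h); last exact: sg_comm.
by apply: le_trans (SM _ _) _ => //; rewrite ler_wpM2l.
Qed.

(** Preimages [y k] of [g] under [S (k + 1)] that converge along [U] are close to each other.
    Applying [S (m + 1)] to [y k] and [y m] yields [S (m - k) g] and [g]. *)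
Lemma reversible_recurrent g (e : R) (N : nat) : reversible g -> 0 < e ->
  exists n : nat, [/\ (N <= n)%N, (0 < n)%N & `|S n%:R g - g| <= e].
Proof.
move=> [C hC] e0.
(* The time is doubled: one half makes the [y k] converge, the other leads from [y k] to [g]. *)
have /choice[h hh] (k : nat) : exists h, `|h| <= C /\ S (k.+1%:R + k.+1%:R) h = g.
  by have [|h] := hC (k.+1%:R + k.+1%:R); [rewrite addr_gt0|exists h].
pose y k := S k.+1%:R (h k).
have yg k : S k.+1%:R (y k) = g by rewrite /y -sg_add //; case: (hh k).
have [l yl] : exists l : E, y k @[k --> U] --> l.
  apply: (@sg_orbit_cvg (fun k => k.+1%:R) h C).
    move=> A; apply: filterS (ultra_near_gtr Uoo A) => k Ak.
    by apply: lt_trans Ak _; rewrite ltr_nat.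
  by apply: filterE => k; case: (hh k).
have D0 : 0 < 2 * M + 1 by rewrite ltr_wpDl // mulr_ge0.
have /cvgrPdist_le /(_ _ (divr_gt0 e0 D0)) near_l := yl.
have [k kl] := filter_ex near_l.
have [m [ml mk]] := filter_ex (filterI near_l (ultra_near_ge Uoo (k + N).+1)).
exists (m - k)%N; have km : (k < m)%N by apply: leq_trans mk; rewrite ltnS leq_addr.
split; rewrite ?subn_gt0 //.
  by rewrite leq_subRL ?(ltnW km)// ltnW.
have e1 : S m.+1%:R (y k) = S (m - k)%:R g.
  rewrite -(yg k) -sg_add ?ltr0n ?subn_gt0 //.
  by rewrite -natrD addnS subnK // ltnW.
rewrite -e1 -(yg m) -(lin_sub (sg_lin sgS (ltr0Sn R m))).
apply: le_trans (SM _ _) _; rewrite ?ltr0n //.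
have : `|y k - y m| <= 2 * (e / (2 * M + 1)).
  have -> : y k - y m = (l - y m) - (l - y k) by rewrite opprB [RHS]addrC addrA subrK.
  by apply: le_trans (ler_normB _ _) _; rewrite mulr_natl mulr2n lerD.
move=> /(ler_wpM2l M0) h1; apply: le_trans h1 _.
have -> : M * (2 * (e / (2 * M + 1))) = 2 * M / (2 * M + 1) * e by ring.
by rewrite ler_piMl ?(ltW e0)// ler_pdivrMr // mul1r lerDl.
Qed.

(** [g] is itself a limit of [S (m k) g] with [m k] tending to infinity. This converse shows that
    absolute values of reversible vectors are reversible, because recurrence survives 1-Lipschitz
    maps commuting with [S]. *)
Lemma recurrent_reversible g :
  (forall (e : R) (N : nat), 0 < e ->
    exists n : nat, [/\ (N <= n)%N, (0 < n)%N & `|S n%:R g - g| <= e]) ->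
  reversible g.
Proof.
move=> h; have /choice[m hm] (k : nat) := h k.+1%:R^-1 k (ltac:(by rewrite invr_gt0)).
apply: (@sg_orbit_lim_reversible (fun k => (m k)%:R) (fun=> g) `|g|).
- move=> A; apply: filterS (ultra_near_gtr Uoo A) => k Ak.
  by apply: lt_le_trans Ak _; rewrite ler_nat; case: (hm k).
- exact: filterE.
- apply/cvgrPdist_le => e e0; apply: filterS (ultra_near_gtr Uoo e^-1) => k ek.
  case: (hm k) => _ _; rewrite distrC => /le_trans; apply.
  rewrite invf_ple ?posrE //; apply: (le_trans (ltW ek)).
  by rewrite ler_nat.
Qed.

(** The preimage is a limit of [S (k + 1) (h k)] with [S (t + (k + 1)) (h k) = g], hence again
    reversible. *)
Lemma reversible_surj (t : R) g : 0 < t -> reversible g ->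
  exists2 h, reversible h & S t h = g.
Proof.
move=> t0 [C hC].
have /choice[h hh] (k : nat) : exists h, `|h| <= C /\ S (t + k.+1%:R) h = g.
  by have [|h] := hC (t + k.+1%:R); [rewrite addr_gt0|exists h].
have kU A : \forall k \near U, A < k.+1%:R :> R.
  apply: filterS (ultra_near_gtr Uoo A) => k Ak.
  by apply: lt_trans Ak _; rewrite ltr_nat.
have hC' : \forall k \near U, `|h k| <= C by apply: filterE => k; case: (hh k).
have [l yl] := sg_orbit_cvg kU hC'.
exists l; first exact: sg_orbit_lim_reversible kU hC' yl.
apply: (ultra_lim_unique_near UU (linear_cvg UU (sg_bounded_op sgS t0) yl) (cvg_cst g)).
by apply: filterE => k; rewrite -sg_add //; case: (hh k).
Qed.

(** An orbit that reaches 0 stays there and cannot return to [g]. *)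
Lemma reversible_inj (t : R) g : 0 < t -> reversible g -> S t g = 0 -> g = 0.
Proof.
move=> t0 rg h; apply/normr0_eq0/eqP; rewrite eq_le normr_ge0 andbT.
apply/ler_addgt0Pr => e e0; rewrite add0r.
have [n [tn n0]] := reversible_recurrent (Num.truncn t).+1 rg e0.
have {}tn : t < n%:R by apply: lt_le_trans (truncnS_gt _) _; rewrite ler_nat.
rewrite (sg_sub sgS _ _ tn) // sg_comm ?subr_gt0 // h.
by rewrite (lin_zero (sg_lin sgS _)) ?subr_gt0 // sub0r normrN.
Qed.

(** By recurrence [a i] is within [e / 2] of some [S (m i) (a i)] with [m i >= i], and those vectors
    converge along [U]. *)
Lemma reversible_near_lim (a : nat -> E) (C e : R) : 0 < e ->
  (forall i, reversible (a i) /\ `|a i| <= C) ->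
  exists2 l, reversible l /\ `|l| <= C + e &
    \forall i \near U, `|l - a i| <= e.
Proof.
move=> e0 ha; have e2 : 0 < e / 2 by rewrite divr_gt0.
have /choice[m hm] (i : nat) := reversible_recurrent i (ha i).1 e2.
have mU A : \forall i \near U, A < (m i)%:R :> R.
  apply: filterS (ultra_near_gtr Uoo A) => i Ai.
  by apply: lt_le_trans Ai _; rewrite ler_nat; case: (hm i).
have aC : \forall i \near U, `|a i| <= C by apply: filterE => i; case: (ha i).
have [l yl] := sg_orbit_cvg mU aC.
have la : \forall i \near U, `|l - a i| <= e.
  have /cvgrPdist_le /(_ _ e2) := yl; apply: filterS => i li.
  have -> : l - a i = (l - S (m i)%:R (a i)) + (S (m i)%:R (a i) - a i).
    by rewrite addrA subrK.
  apply: le_trans (ler_normD _ _) _; rewrite [leRHS]splitr lerD //.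
  by case: (hm i).
exists l => //; split; first exact: sg_orbit_lim_reversible mU aC yl.
have [i [h1 h2]] := filter_ex (filterI la aC).
have -> : l = a i + (l - a i) by rewrite addrC subrK.
by apply: le_trans (ler_normD _ _) _; rewrite lerD.
Qed.

(** [N] precedes the sequence, since [atom_eigen] builds its sequence from [N]. Were there
    counterexamples for every [N], near-limits taken first over [N] and then over the index would
    bring two separated terms together. *)
Lemma reversible_totally_bounded (C e : R) : 0 < e -> exists N : nat,
  forall a : nat -> E, (forall i, reversible (a i) /\ `|a i| <= C) ->
  exists i j : nat, [/\ (i < j)%N, (j <= N)%N & `|a i - a j| < e].
Proof.
move=> e0; apply: contrapT => h.
have /choice[a ha] (N : nat) : exists a : nat -> E,
    (forall i, reversible (a i) /\ `|a i| <= C) /\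
    forall i j, (i < j)%N -> (j <= N)%N -> e <= `|a i - a j|.
  apply: contrapT => hN; apply: h; exists N => a ha; apply: contrapT => hij.
  apply: hN; exists a; split=> // i j ij jN; rewrite leNgt; apply/negP => lt.
  by apply: hij; exists i, j.
have e8 : 0 < e / 8 by rewrite divr_gt0.
have /choice[b hb] (i : nat) : exists l, (reversible l /\ `|l| <= C + e / 8) /\
    \forall N \near U, `|l - a N i| <= e / 8.
  have [|l ? ?] := @reversible_near_lim (fun N => a N i) C _ e8; last by exists l.
  by move=> N; case: (ha N) => /(_ i).
have [l _ hl] := reversible_near_lim e8 (fun i => (hb i).1).
have [i il] := filter_ex hl.
have [j [jl ij]] := filter_ex (filterI hl (ultra_near_ge Uoo i.+1)).
have [N [iN [jN jle]]] :=
  filter_ex (filterI (hb i).2 (filterI (hb j).2 (ultra_near_ge Uoo j))).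
have := (ha N).2 i j ij jle; rewrite leNgt => /negP; apply.
have -> : a N i - a N j = (l - b j) + (b j - a N j) - ((l - b i) + (b i - a N i)).
  by rewrite ![l - _ + _]addrA !subrK opprB [RHS]addrC addrA subrK.
apply: (@le_lt_trans _ _ (e / 8 + e / 8 + (e / 8 + e / 8))); last by lra.
apply: le_trans (ler_normB _ _) _; apply: lerD;
  by apply: le_trans (ler_normD _ _) _; rewrite lerD.
Qed.

End Reversible.

(** * The reversible vectors form a one-dimensional lattice *)

Section Atoms.
Variables (R : realType) (E : completeNormedModType R) (L : banach_lattice E).
Variable S : R -> E -> E.
Hypothesis sgS : semigroup S.
Hypothesis posS : positive_sg L S.
Hypothesis irrS : irreducible_sg L S.
Hypothesis acS : asymptotically_compact S.
Variable phi : E -> R.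
Hypothesis phi0 : spos_functional L phi.
Hypothesis phi1 : forall x, phi (S 1 x) = phi x.
Variable M : R.
Hypothesis M0 : 0 <= M.
Hypothesis SM : forall t x, 0 < t -> `|S t x| <= M * `|x|.
Variable U : set_system nat.
Hypothesis UU : UltraFilter U.
Hypothesis Uoo : \oo `<=` U.

Local Notation "x <=L y" := (bl_le L x y) (at level 70, y at next level).
Local Notation rev := (reversible S).
Local Notation abs := (bl_abs L).
Local Notation pp := (bl_pp L).
Local Notation meet := (bl_meet L).

Let phiL : forall (a : R) x y, phi (a *: x + y) = a * phi x + phi y.
Proof. by case: phi0 => [[]]. Qed.

Let phi_ge0 x : 0 <=L x -> 0 <= phi x.
Proof. by case: phi0 => _ [+ _]; apply. Qed.

Let phiB x y : phi (x - y) = phi x - phi y.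
Proof. by rewrite (@lin_sub _ _ R^o _ phiL). Qed.

Let phi_mono x y : x <=L y -> phi x <= phi y.
Proof. by move=> /bl_subr_ge0 /phi_ge0; rewrite phiB subr_ge0. Qed.

Let sg_mono t x y : 0 < t -> x <=L y -> S t x <=L S t y.
Proof. by move=> t0; apply: pos_op_mono; [exact: sg_lin|exact: posS]. Qed.

Let sgL t (t0 : 0 < t) := sg_lin sgS t0.
Let recur := reversible_recurrent sgS acS M0 SM UU Uoo.
Let revZ (a : R) g := @reversibleZ _ _ _ sgS a g.
Let revB g h := @reversibleB _ _ _ sgS g h.
Let revD g h := @reversibleD _ _ _ sgS g h.
Let rev_sg s g := @reversible_sg _ _ _ sgS _ M0 SM s g.
Let rev_inj t g := @reversible_inj _ _ _ sgS acS _ M0 SM _ UU Uoo t g.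

(** By recurrence [|g|] is close to [|S m g|], which is at most [S (m - t) |S t g|]. Under
    [phi o S (s + t)] the latter has the value [phi (S s |S t g|)], by integer invariance. So every
    [phi o S s] kills the positive vector [S t |g| - |S t g|]. *)
Lemma reversible_abs_sg t g : 0 < t -> rev g -> abs (S t g) = S t (abs g).
Proof.
move=> t0 rg; apply/eqP; rewrite eq_sym -subr_eq0; apply/eqP.
apply: (irreducible_eq0 irrS phi0).
  by apply/bl_subr_ge0; apply: pos_op_abs; [exact: sgL|exact: posS].
move=> s s0; rewrite (lin_sub (sgL s0)) phiB subr_le0 -sg_add //.
have st0 : 0 < s + t by rewrite addr_gt0.
have [psiL [C hC]] := invariant_dual sgS phi0 st0.
apply/ler_addgt0Pr => e e0; have D0 : 0 < `|C| + 1 by rewrite ltr_wpDl.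
have [m [tm m0 hm]] := recur (Num.truncn t).+1 rg (divr_gt0 e0 D0).
have {}tm : t < m%:R by apply: lt_le_trans (truncnS_gt _) _; rewrite ler_nat.
have mt0 : 0 < m%:R - t by rewrite subr_gt0.
have -> : phi (S (s + t) (abs g)) =
    phi (S (s + t) (abs (S m%:R g))) + phi (S (s + t) (abs g - abs (S m%:R g))).
  by rewrite (lin_sub (sgL st0)) phiB [RHS]addrC subrK.
apply: lerD.
  have -> : phi (S s (abs (S t g))) = phi (S (s + t) (S (m%:R - t) (abs (S t g)))).
    rewrite -(sg_add sgS _ st0 mt0).
    have -> : s + t + (m%:R - t) = m%:R + s by ring.
    by rewrite sg_add ?ltr0n // (invariant_nat sgS phi1).
  apply: phi_mono; apply: sg_mono => //; rewrite (sg_sub sgS _ t0 tm) sg_comm //.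
  by apply: pos_op_abs; [exact: sgL|exact: posS].
apply: le_trans (ler_norm _) _; apply: le_trans (hC _) _.
apply: (@le_trans _ _ ((`|C| + 1) * (e / (`|C| + 1)))); last first.
  by rewrite mulrC divfK // gt_eqF.
apply: (@le_trans _ _ ((`|C| + 1) * `|abs g - abs (S m%:R g)|)).
  by rewrite ler_wpM2r // (le_trans (ler_norm C))// lerDl.
rewrite ler_wpM2l ?(ltW D0)//; apply: le_trans (bl_norm_absB _ _ _) _.
by rewrite distrC.
Qed.

Lemma reversible_abs g : rev g -> rev (abs g).
Proof.
move=> rg; apply: (recurrent_reversible sgS acS M0 SM UU Uoo) => e N e0.
have [n [Nn n0 hn]] := recur N rg e0; exists n; split=> //.
rewrite -reversible_abs_sg ?ltr0n //; exact: le_trans (bl_norm_absB _ _ _) hn.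
Qed.

Lemma reversible_pp g : rev g -> rev (pp g).
Proof. by move=> rg; rewrite bl_pp_abs; apply/revZ/revD => //; exact: reversible_abs. Qed.

Lemma reversible_meet g h : rev g -> rev h -> rev (meet g h).
Proof. by move=> rg rh; rewrite bl_meetE; apply/revB => //; exact/reversible_pp/revB. Qed.

(** [g] and its absolute value have the same image, and [S t] is injective on reversible vectors. *)
Lemma reversible_sg_ge0 t g : 0 < t -> rev g -> 0 <=L S t g -> 0 <=L g.
Proof.
move=> t0 rg h; suff <- : abs g = g by exact: bl_abs_ge0.
apply/eqP; rewrite -subr_eq0; apply/eqP.
apply: (rev_inj t0); first by apply: revB => //; exact: reversible_abs.
by rewrite (lin_sub (sgL t0)) -reversible_abs_sg // bl_abs_id // subrr.
Qed.

(** Atoms of the lattice of reversible vectors, not of [E]: only reversible minorants are tested. *)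
Definition atom a := [/\ rev a, 0 <=L a, a <> 0 &
  forall b, rev b -> 0 <=L b -> b <=L a -> exists c : R, b = c *: a].

(** Disjoint positive unit vectors have distance at least 1, against total boundedness. *)
Lemma no_disjoint_sequence (d : nat -> E) :
  (forall i, [/\ rev (d i), 0 <=L d i & d i <> 0]) ->
  ~ forall i j, (i < j)%N -> meet (d i) (d j) = 0.
Proof.
move=> hd dis; pose a i := `|d i|^-1 *: d i.
have dn i : 0 < `|d i|.
  by rewrite normr_gt0; apply/eqP; case: (hd i).
have a1 i : `|a i| = 1 by rewrite normrZ gtr0_norm ?invr_gt0 // mulVf ?gt_eqF.
have [N hN] := reversible_totally_bounded sgS acS M0 SM UU Uoo 1 ltr01.
have [i|i [j [ij _]]] := hN a.
  by rewrite a1; split=> //; apply: revZ; case: (hd i).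
have [_ i0 _] := hd i; have [_ j0 _] := hd j.
have ai k : 0 <=L d k -> 0 <=L a k by move=> ?; apply: bl_scaler_ge0; rewrite ?invr_ge0.
rewrite ltNge -(a1 i) (@bl_norm_disjoint _ _ L) //; [exact: ai|exact: ai|].
by apply: bl_meet0Z; rewrite ?invr_ge0 //; exact: dis.
Qed.

(** If [a] is no atom, some [b] below it is incomparable with some [c a], and the two parts of
    [b - c a] are nonzero, disjoint and below [a]. Repeated splitting produces an infinite disjoint
    sequence. *)
Lemma atom_exists : (exists2 g, rev g & g <> 0) -> exists a, atom a.
Proof.
move=> [g rg gn]; apply: contrapT => noatom.
pose P a := [/\ rev a, 0 <=L a & a <> 0].
have split_P (a : {a | P a}) : exists dd : {a | P a} * {a | P a},
    [/\ sval dd.1 <=L sval a, sval dd.2 <=L sval a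
      & meet (sval dd.1) (sval dd.2) = 0].
  case: a => a [ra a0 an] /=.
  have [b [rb b0 ba nb]] : exists b, [/\ rev b, 0 <=L b, b <=L a
      & ~ exists c : R, b = c *: a].
    apply: contrapT => h; apply: noatom; exists a; split=> // b rb b0 ba.
    by apply: contrapT => nb; apply: h; exists b.
  have [c [/andP[c0 c1] n1 n2]] : exists c : R,
      [/\ 0 <= c <= 1, ~ b <=L c *: a & ~ c *: a <=L b].
    apply: contrapT => h; apply: nb; apply: (@bl_comparable_multiple _ _ L) => // c c01.
    have [?|n1] := pselect (b <=L c *: a); first by left.
    by right; apply: contrapT => n2; apply: h; exists c.
  have rbc : rev (b - c *: a) by apply: revB => //; exact: revZ.
  have Pd : P (pp (b - c *: a)).
    split; [exact: reversible_pp|exact: bl_pp_ge0|move=> h; apply: n1].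
    apply/bl_subr_ge0; rewrite -opprB -[0]oppr0; apply: bl_leN.
    by rewrite -h; exact: bl_pp_ge.
  have Pa : P (pp (- (b - c *: a))).
    split; [|exact: bl_pp_ge0|move=> h; apply: n2].
      by apply: reversible_pp; rewrite -scaleN1r; exact: revZ.
    apply/bl_subr_ge0; rewrite -[X in _ <=L X]opprK -[0]oppr0; apply: bl_leN.
    by rewrite -h; exact: bl_pp_ge.
  exists (exist _ _ Pd, exist _ _ Pa); split=> /=.
  - apply: bl_join_least => //; apply: bl_trans ba.
    apply/bl_subr_ge0; rewrite opprB addrC subrK; exact: bl_scaler_ge0.
  - rewrite opprB; apply: bl_join_least => //.
    apply: (@bl_trans _ _ L _ (c *: a)).
      by apply/bl_subr_ge0; rewrite opprB addrC subrK.
    by rewrite -[X in _ <=L X]scale1r; exact: bl_ler_scale.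
  - exact: bl_meet_pp.
have /choice[f hf] := split_P.
have Pg : P (abs g).
  split; [exact: reversible_abs|exact: bl_abs_ge0|move=> h; apply: gn].
  by apply: normr0_eq0; rewrite -(bl_norm_abs L) h normr0.
(* The second piece is split further each time; the first pieces then form the disjoint sequence. *)
pose s n : {a | P a} := iter n (fun a => (f a).2) (exist _ _ Pg).
have s_le m n : (m <= n)%N -> sval (s n) <=L sval (s m).
  move=> /subnK <-; elim: (n - m)%N => [|k ih]; first exact: bl_refl.
  by rewrite addSn; apply: bl_trans ih; case: (hf (s (k + m)%N)).
apply: (@no_disjoint_sequence (fun n => sval (f (s n)).1)).
  by move=> i; exact: (svalP (f (s i)).1).
move=> i j ij; have [_ _ d] := hf (s i).
have [h1 _ _] := hf (s j); have [_ i0 _] := svalP (f (s i)).1.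
have [_ j0 _] := svalP (f (s j)).1.
apply: bl_meet0_sub d => //; first exact: bl_refl.
exact: bl_trans h1 (s_le _ _ ij).
Qed.

(** On reversible vectors [S t] is bijective and positive in both directions, so minorants of
    [S t a] pull back to minorants of [a]. *)
Lemma atom_sg t a : 0 < t -> atom a -> atom (S t a).
Proof.
move=> t0 [ra a0 an atm]; split; [exact: rev_sg|exact: posS| |].
  by move=> /(rev_inj t0 ra).
move=> b rb b0 ba.
have [b' rb' e] := reversible_surj sgS acS M0 SM UU Uoo t0 rb.
have b'0 : 0 <=L b' by apply: (reversible_sg_ge0 t0 rb'); rewrite e.
have b'a : b' <=L a.
  apply/bl_subr_ge0; apply: (reversible_sg_ge0 t0); first exact: revB.
  by rewrite (lin_sub (sgL t0)) e; apply/bl_subr_ge0.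
have [c bc] := atm _ rb' b'0 b'a; exists c.
by rewrite -e bc (lin_scale (sgL t0)).
Qed.

Lemma atom_multiple a b : atom a -> atom b -> meet a b <> 0 ->
  exists c : R, b = c *: a.
Proof.
move=> [ra a0 an ata] [rb b0 bn atb] mn.
have rm := reversible_meet ra rb.
have m0 : 0 <=L meet a b by exact: bl_meet_greatest.
have [c hc] := ata _ rm m0 (bl_meet_l _ _ _).
have [d hd] := atb _ rm m0 (bl_meet_r _ _ _).
have dn : d != 0 by apply/eqP => d0; apply: mn; rewrite hd d0 scale0r.
by exists (c / d); rewrite mulrC -scalerA -hc hd scalerA mulVf // scale1r.
Qed.

(* The permutation that S t induces on the atoms is an N!-th power, hence trivial. *)
Lemma atom_eigen t a : 0 < t -> atom a -> exists c : R, S t a = c *: a.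
Proof.
move=> t0 ata; have [N hN] := reversible_totally_bounded sgS acS M0 SM UU Uoo 1 ltr01.
(* Every [k + 1 <= N] divides [N!], so [t] is a multiple of whichever period [(k + 1) tau] is found
   below. *)
pose tau := t / N`!%:R.
have tau0 : 0 < tau by rewrite divr_gt0 // ltr0n fact_gt0.
have kt0 k : 0 < k.+1%:R * tau by rewrite mulr_gt0.
have at_ i : atom (S (i.+1%:R * tau) a) by exact: atom_sg.
have nn i : 0 < `|S (i.+1%:R * tau) a|.
  by rewrite normr_gt0; apply/eqP; case: (at_ i).
pose b i := `|S (i.+1%:R * tau) a|^-1 *: S (i.+1%:R * tau) a.
have b1 i : `|b i| = 1 by rewrite normrZ gtr0_norm ?invr_gt0 // mulVf ?gt_eqF.
have [i|i [j [ij jN]]] := hN b.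
  by rewrite b1; split=> //; apply: revZ; case: (at_ i).
have [ri i0 _ _] := at_ i; have [rj j0 _ _] := at_ j.
have bi k : 0 <=L S (k.+1%:R * tau) a -> 0 <=L b k.
  by move=> ?; apply: bl_scaler_ge0; rewrite ?invr_ge0.
(* Two of the normalised atoms are closer than 1, so they are not disjoint and hence proportional;
   cancelling the earlier time gives [S ((k + 1) tau) a = c a]. *)
move=> bij; have mn : meet (S (i.+1%:R * tau) a) (S (j.+1%:R * tau) a) <> 0.
  move=> d; move: bij; rewrite ltNge -(b1 i) (@bl_norm_disjoint _ _ L) //;
    [exact: bi|exact: bi|].
  by apply: bl_meet0Z; rewrite ?invr_ge0.
have [c hc] := atom_multiple (at_ i) (at_ j) mn.
have [k kE] : exists k, (j = i + k.+1)%N.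
  by exists (j - i).-1; rewrite prednK ?subn_gt0 // subnKC // ltnW.
have ck : S (k.+1%:R * tau) a = c *: a.
  apply/eqP; rewrite -subr_eq0; apply/eqP; have [ra _ _ _] := ata.
  apply: (rev_inj (kt0 i)); first by apply: revB; [apply: rev_sg|exact: revZ].
  rewrite (lin_sub (sgL (kt0 i))) (lin_scale (sgL (kt0 i))) -hc -sg_add //.
  by rewrite -mulrDl -natrD addSn -kE subrr.
have pw m : S (m.+1%:R * (k.+1%:R * tau)) a = c ^+ m.+1 *: a.
  elim: m => [|m ih]; first by rewrite mul1r ck.
  have m0 : 0 < m.+1%:R * (k.+1%:R * tau) by rewrite mulr_gt0.
  rewrite -natr1 mulrDl mul1r sg_add // ck (lin_scale (sgL m0)) ih scalerA.
  by rewrite -exprS.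
have /dvdnP[q qE] : (k.+1 %| N`!)%N.
  by apply: dvdn_fact; rewrite /= (leq_trans _ jN) // kE leq_addl.
have q0 : (0 < q)%N by case: q qE (fact_gt0 N) => // ->.
exists (c ^+ q); rewrite -(prednK q0) -pw prednK // mulrA -natrM -qE.
by rewrite mulrC divfK // pnatr_eq0 -lt0n fact_gt0.
Qed.

End Atoms.

(** * Quasi-interior eigenvectors *)

Section QuasiInterior.
Variables (R : realType) (E : completeNormedModType R) (L : banach_lattice E).
Variable S : R -> E -> E.
Hypothesis irrS : irreducible_sg L S.
Variable a : E.
Hypothesis a0 : bl_le L 0 a.
Local Notation pp := (bl_pp L).

(** For positive [x] this is the distance to the ideal generated by [a]. Through the positive part,
    linear functionals below it are positive and vanish at [a]. *)
Definition ideal_dist x := inf [set `|pp (x - r *: a)| | r in [set r : R | 0 <= r]].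

Lemma ideal_dist_le x (r : R) : 0 <= r -> ideal_dist x <= `|pp (x - r *: a)|.
Proof. by move=> r0; apply: ge_inf; [exists 0 => _ [s _ <-]|exists r]. Qed.

Lemma ideal_dist_ge x (c : R) :
  (forall r, 0 <= r -> c <= `|pp (x - r *: a)|) -> c <= ideal_dist x.
Proof.
move=> h; apply: lb_le_inf; first by exists `|pp (x - 0 *: a)|, 0 => /=.
by move=> _ [r r0 <-]; exact: h.
Qed.

Lemma sublinear_ideal_dist : sublinear ideal_dist.
Proof.
have half (b : R) x : 0 < b -> b * ideal_dist x <= ideal_dist (b *: x).
  move=> b0; apply: ideal_dist_ge => r r0.
  have rb : 0 <= r / b by rewrite divr_ge0 // ltW.
  have -> : b *: x - r *: a = b *: (x - (r / b) *: a).
    by rewrite scalerBr scalerA mulrC divfK ?gt_eqF.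
  rewrite (bl_ppZ _ _ (ltW b0)) normrZ gtr0_norm //.
  by rewrite ler_wpM2l ?(ltW b0)// ideal_dist_le.
split=> [b x|x y].
  rewrite le_eqVlt => /predU1P[<-|b0].
    rewrite scale0r mul0r; apply/eqP; rewrite eq_le; apply/andP; split.
      by have := ideal_dist_le 0 (lexx 0); rewrite scale0r subr0 bl_pp0 normr0.
    by apply: ideal_dist_ge.
  apply/eqP; rewrite eq_le half // andbT.
  have := half b^-1 (b *: x); rewrite invr_gt0 b0 => /(_ isT).
  by rewrite scalerA mulVf ?gt_eqF// scale1r ler_pdivrMl.
rewrite -lerBlDr; apply: ideal_dist_ge => r r0; rewrite lerBlDr -lerBlDl.
apply: ideal_dist_ge => s s0; rewrite lerBlDl.
apply: le_trans (ideal_dist_le _ (addr_ge0 r0 s0)) _; apply: le_trans _ (ler_normD _ _).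
rewrite scalerDl opprD addrACA.
by apply: (bl_norm_le (bl_pp_ge0 _ _)); exact: bl_ppD.
Qed.

(** If some [v] had positive distance to the ideal of [a], Hahn-Banach would give a nonzero positive
    functional vanishing at [a], hence on its whole orbit, against irreducibility. *)
Lemma quasi_interior_eigen : a <> 0 ->
  (forall t, 0 < t -> exists c : R, S t a = c *: a) -> quasi_interior L a.
Proof.
move=> an eig; split=> // v v0.
have dv : ideal_dist v <= 0.
  rewrite leNgt; apply/negP => dv.
  have [f [fL fd fv]] := hahn_banach v sublinear_ideal_dist.
  have fN x : f (- x) = - f x by rewrite (@lin_opp _ _ R^o).
  have f_le x : f x <= `|pp x|.
    apply: le_trans (fd x) _; have := ideal_dist_le x (lexx 0).
    by rewrite scale0r subr0.
  have f0 x : bl_le L 0 x -> 0 <= f x.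
    move=> x0; rewrite -oppr_le0 -fN; apply: le_trans (f_le _) _.
    by rewrite bl_pp_eq0 ?normr0 // -[0]oppr0; exact: bl_leN.
  have fa : f a = 0.
    apply/eqP; rewrite eq_le f0 // andbT; apply: le_trans (fd a) _.
    by have := ideal_dist_le a ler01; rewrite scale1r subrr bl_pp0 normr0.
  have fbd x : `|f x| <= 1 * `|x|.
    have f_le' y : f y <= `|y| by apply: le_trans (f_le y) (bl_norm_pp _ _).
    by rewrite mul1r ler_norml lerNl -fN f_le' -normrN f_le'.
  have sf : spos_functional L f.
    split; [by split=> //; exists 1|split=> //].
    by exists v; apply/eqP; rewrite gt_eqF // fv.
  have [t [t0]] := irrS (conj a0 an) sf.
  have [c ->] := eig t t0.
  by rewrite (@lin_scale _ _ R^o _ fL) fa scaler0 ltxx.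
apply/cvgrPdist_le => e e0.
have [r r0 re] : exists2 r : R, 0 <= r & `|pp (v - r *: a)| < e.
  have /inf_lt[|_ [r r0 <-] re] := le_lt_trans dv e0; last by exists r.
  by exists `|pp (v - 0 *: a)|, 0 => /=.
apply: filterS (nbhs_infty_gtr r) => n rn.
rewrite bl_meetE subKr; apply: le_trans (ltW re).
apply: bl_norm_le; first exact: bl_pp_ge0.
apply: bl_le_pp; apply: bl_leD; first exact: bl_refl.
by apply: bl_leN; apply: bl_ler_scale => //; exact: ltW.
Qed.

End QuasiInterior.

(** * Convergence *)

Section Convergence.
Variables (R : realType) (E : completeNormedModType R) (L : banach_lattice E).
Variable S : R -> E -> E.
Hypothesis sgS : semigroup S.
Hypothesis posS : positive_sg L S.
Hypothesis irrS : irreducible_sg L S.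
Hypothesis acS : asymptotically_compact S.
Variable phi : E -> R.
Hypothesis phi0 : spos_functional L phi.
Hypothesis phi1 : forall x, phi (S 1 x) = phi x.
Variable M : R.
Hypothesis M0 : 0 <= M.
Hypothesis SM : forall t x, 0 < t -> `|S t x| <= M * `|x|.
Variable U : set_system nat.
Hypothesis UU : UltraFilter U.
Hypothesis Uoo : \oo `<=` U.

Let phiL : forall (a : R) x y, phi (a *: x + y) = a * phi x + phi y.
Proof. by case: phi0 => [[]]. Qed.

Let phiZ (c : R) x : phi (c *: x) = c * phi x.
Proof. by rewrite (@lin_scale _ _ R^o _ phiL). Qed.

Let phiD : dual_elt phi. Proof. by case: phi0. Qed.

Let natU A : \forall k \near U, A < k.+1%:R :> R.
Proof.
apply: filterS (ultra_near_gtr Uoo A) => k Ak.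
by apply: lt_trans Ak _; rewrite ltr_nat.
Qed.

(** Absence of decay gives [x] in the unit ball with images of norm at least 1/2 at arbitrarily late
    times; their limit is reversible and nonzero. *)
Lemma reversible_neq0 : growth_bound S = 0%E -> exists2 g, reversible S g & g <> 0.
Proof.
move=> gbS.
have /choice[X hX] (n : nat) : exists x, `|x| <= 1 /\ 2^-1 <= `|S n.+1%:R x|.
  have [x hx] : exists x, 2^-1 * `|x| < `|S n.+1%:R x|.
    apply: contrapT => h; apply: (@sg_no_decay _ _ _ sgS gbS n.+1%:R 2^-1) => //.
      by rewrite invf_lt1 // ltr1n.
    by move=> x; rewrite leNgt; apply/negP => ?; apply: h; exists x.
  have sl := sg_lin sgS (ltr0Sn R n).
  have xn : 0 < `|x|.
    rewrite lt0r normr_ge0 andbT; apply/eqP => h.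
    by move: hx; rewrite (normr0_eq0 h) (lin_zero sl) normr0 mulr0 ltxx.
  exists (`|x|^-1 *: x); rewrite (lin_scale sl) !normrZ gtr0_norm ?invr_gt0 //.
  by rewrite mulVf ?gt_eqF //; split=> //; rewrite ler_pdivlMl // mulrC ltW.
have X1 : \forall k \near U, `|X k| <= 1 by apply: filterE => k; case: (hX k).
have [l yl] := sg_orbit_cvg sgS acS M0 SM UU natU X1.
exists l; first exact: (sg_orbit_lim_reversible sgS acS M0 SM UU natU X1 yl).
move=> l0; have e4 : (0 : R) < 4^-1 by rewrite invr_gt0.
have /cvgrPdist_le /(_ _ e4) := yl; case/filter_ex => k.
by rewrite l0 sub0r normrN => hk; case: (hX k) => _; lra.
Qed.

(** A positive [b] is the limit of its meets with [n a], each a multiple of [a] by atomicity, with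
    the factor read off by [phi]. The form without division avoids assuming [phi a] nonzero. *)
Lemma reversible_atom_span a g : atom L S a -> reversible S g ->
  phi a *: g = phi g *: a.
Proof.
move=> ata; have [ra a0 an at_a] := ata.
have eig t (t0 : 0 < t) :=
  atom_eigen sgS posS irrS acS phi0 phi1 M0 SM UU Uoo t0 ata.
have [_ qi] := quasi_interior_eigen irrS a0 an eig.
have pos_case b : reversible S b -> bl_le L 0 b -> phi a *: b = phi b *: a.
  move=> rb b0; pose y n := bl_meet L b (n%:R *: a).
  have yb : y n @[n --> U] --> b by move=> A hA; apply: Uoo; exact: qi hA.
  have c1 : phi a *: y n @[n --> U] --> phi a *: b.
    apply: (@lipschitz_cvg _ _ UU _ _ ( *:%R (phi a)) `|phi a|) yb => u v.
    by rewrite -scalerBr normrZ.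
  have c2 : phi (y n) *: a @[n --> U] --> phi b *: a by apply: cvgZr_tmp; exact: dual_cvg.
  apply: (ultra_lim_unique_near UU c1 c2).
  apply: filterS (ultra_near_ge Uoo 1) => n n0.
  have n0' : 0 < n%:R :> R by rewrite ltr0n.
  have y0 : bl_le L 0 (y n).
    by apply: bl_meet_greatest => //; apply: bl_scaler_ge0.
  have ry : reversible S (y n).
    apply: (reversible_meet sgS posS irrS acS phi0 phi1 M0 SM UU Uoo) => //.
    exact: reversibleZ.
  have [||c hc] := at_a (n%:R^-1 *: y n) (reversibleZ sgS _ ry).
  - by apply: bl_scaler_ge0 => //; rewrite invr_ge0.
  - have : bl_le L (n%:R^-1 *: y n) (n%:R^-1 *: (n%:R *: a)).
      by apply: bl_scale; [rewrite invr_ge0|exact: bl_meet_r].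
    by rewrite scalerA mulVf ?gt_eqF // scale1r.
  - have -> : y n = (n%:R * c) *: a.
      by rewrite -scalerA -hc scalerA divff ?gt_eqF // scale1r.
    by rewrite phiZ !scalerA mulrC.
move=> rg; have rgN : reversible S (- g) by rewrite -scaleN1r; exact: reversibleZ.
have rpp h : reversible S h -> reversible S (bl_pp L h).
  exact: (reversible_pp sgS posS irrS acS phi0 phi1 M0 SM UU Uoo).
rewrite -(bl_pp_sub L g) scalerBr !pos_case; try exact: rpp; try exact: bl_pp_ge0.
by rewrite (@lin_sub _ _ R^o _ phiL) scalerBl.
Qed.

Lemma reversible_line : growth_bound S = 0%E -> exists u,
  [/\ reversible S u, bl_le L 0 u, phi u = 1 &
      forall g, reversible S g -> g = phi g *: u].
Proof.
move=> gbS; have [a ata] :=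
  atom_exists sgS posS irrS acS phi0 phi1 M0 SM UU Uoo (reversible_neq0 gbS).
have [ra a0 an _] := ata.
have pa : 0 < phi a.
  rewrite lt0r; apply/andP; split; last by case: phi0 => _ [+ _]; apply.
  have [s [s0]] := irrS (conj a0 an) phi0.
  have [c ->] := atom_eigen sgS posS irrS acS phi0 phi1 M0 SM UU Uoo s0 ata.
  by rewrite phiZ => + ; apply: contraTneq => ->; rewrite mulr0 ltxx.
exists ((phi a)^-1 *: a); split; [exact: reversibleZ| | |].
- by apply: bl_scaler_ge0 => //; rewrite invr_ge0 ltW.
- by rewrite phiZ mulVf ?gt_eqF.
- move=> g rg; rewrite scalerA mulrC -scalerA -reversible_atom_span //.
  by rewrite scalerA mulVf ?gt_eqF // scale1r.
Qed.

Section Line.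
Variable u : E.
Hypothesis ru : reversible S u.
Hypothesis u0 : bl_le L 0 u.
Hypothesis pu : phi u = 1.
Hypothesis span_u : forall g, reversible S g -> g = phi g *: u.

(** The eigenvalue [c] is multiplicative, nonnegative and bounded, so it never exceeds 1. As it
    equals 1 at integers, [c t * c (m - t) = 1] forces [c t = 1] without any continuity. *)
Lemma fixed_line t : 0 < t -> S t u = u.
Proof.
pose c t := phi (S t u).
have cE s : 0 < s -> S s u = c s *: u.
  by move=> s0; apply: span_u; exact: (reversible_sg sgS M0 SM).
have cD s r : 0 < s -> 0 < r -> c (s + r) = c s * c r.
  move=> s0 r0; rewrite {1}/c sg_add // (cE r) // (lin_scale (sg_lin sgS s0)).
  by rewrite phiZ mulrC.
have c0 s : 0 < s -> 0 <= c s.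
  by move=> s0; case: phi0 => _ [+ _]; apply; exact: posS.
have cn n : (0 < n)%N -> c n%:R = 1.
  by move=> n0; rewrite /c (invariant_nat sgS phi1).
pose A := [set c s | s in [set s : R | 0 < s]].
have A1 : A 1 by exists 1; rewrite /= ?ltr01 // /c phi1.
have supA : has_sup A.
  split; first by exists 1.
  case: phiD => _ [C hC]; exists (`|C| * (M * `|u|)) => _ [s s0 <-].
  apply: le_trans (ler_norm _) _; apply: le_trans (hC _) _.
  apply: le_trans (ler_wpM2r _ (ler_norm C)) _ => //.
  by rewrite ler_wpM2l // SM.
have sup1 : 1 <= sup A by apply: ub_le_sup => //; exact: supA.2.
have c1 s : 0 < s -> c s <= 1.
  move=> s0; rewrite leNgt; apply/negP => cs.
  have cs0 : 0 < c s by exact: lt_trans cs.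
  (* Multiplication by [c s] maps the set of values into itself, so a factor above 1 would enlarge a
     finite supremum. *)
  have : sup A <= sup A / c s.
    apply: ge_sup; first by exists 1.
    move=> _ [r r0 <-]; rewrite ler_pdivlMr // mulrC -cD //.
    by apply: ub_le_sup; [exact: supA.2|exists (s + r); rewrite //= addr_gt0].
  rewrite ler_pdivlMr // leNgt => /negP; apply.
  by rewrite ltr_pMr // (lt_le_trans _ sup1).
move=> t0; rewrite cE //.
pose m := (Num.truncn t).+1; have tm : t < m%:R by exact: truncnS_gt.
have mt : 0 < m%:R - t by rewrite subr_gt0.
have : c t * c (m%:R - t) = 1 by rewrite -cD // addrC subrK cn.
move=> ct; suff -> : c t = 1 by rewrite scale1r.
apply/eqP; rewrite eq_le c1 //= -ct ler_piMr //; [exact: c0|exact: c1].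
Qed.

(** The limit [l] of [S (n + 1) x] is a multiple of the fixed vector [u]. Integer invariance
    transfers the claim from [l] to [x], since [phi] and [phi o S t] take the same values at
    both. *)
Lemma invariant_all t x : 0 < t -> phi (S t x) = phi x.
Proof.
move=> t0; have X1 : \forall k \near U, `|x| <= `|x| by exact: filterE.
have [l yl] := sg_orbit_cvg sgS acS M0 SM UU natU X1.
have rl := sg_orbit_lim_reversible sgS acS M0 SM UU natU X1 yl.
have pl : phi l = phi x.
  apply: (ultra_lim_unique UU (dual_cvg UU phiD yl)).
  have -> : (fun n : nat => phi (S n.+1%:R x)) = (fun=> phi x).
    by apply/funext => n; rewrite (invariant_nat sgS phi1).
  exact: cvg_cst.
have <- : phi (S t l) = phi (S t x).
  apply: (ultra_lim_unique UU (dual_cvg UU (invariant_dual sgS phi0 t0) yl)).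
  have -> : (fun n : nat => phi (S t (S n.+1%:R x))) = (fun=> phi (S t x)).
    by apply/funext => n; rewrite sg_comm // (invariant_nat sgS phi1).
  exact: cvg_cst.
by rewrite (span_u rl) (lin_scale (sg_lin sgS t0)) fixed_line // -pl phiZ pu mulr1.
Qed.

(** Along a violating sequence, [S (t n) (x n)] tends to some [l = phi l *: u]. Invariance makes
    [phi (x n)] tend to [phi l], so the supposedly distant sequences share their limit. *)
Lemma uniform_convergence (e : R) : 0 < e -> exists n : nat,
  forall t x, n%:R < t -> `|S t x - phi x *: u| <= e * `|x|.
Proof.
move=> e0; apply: contrapT => h.
have /choice[tx htx] (n : nat) : exists tx : R * E,
    [/\ n%:R < tx.1, `|tx.2| <= 1 & e <= `|S tx.1 tx.2 - phi tx.2 *: u|].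
  apply: contrapT => hn; apply: h; exists n => t x nt.
  rewrite leNgt; apply/negP => lt; apply: hn.
  have t0 : 0 < t by apply: le_lt_trans nt.
  have xn : 0 < `|x|.
    rewrite lt0r normr_ge0 andbT; apply/eqP => x0; move: lt.
    rewrite (normr0_eq0 x0) (lin_zero (sg_lin sgS t0)).
    by rewrite (@lin_zero _ _ R^o _ phiL) scale0r subr0 normr0 mulr0 ltxx.
  exists (t, `|x|^-1 *: x); split=> //=.
    by rewrite normrZ gtr0_norm ?invr_gt0 // mulVf ?gt_eqF.
  rewrite (lin_scale (sg_lin sgS t0)) phiZ -scalerA -scalerBr normrZ.
  by rewrite gtr0_norm ?invr_gt0 // ler_pdivlMl // mulrC ltW.
have tU A : \forall n \near U, A < (tx n).1.
  apply: filterS (ultra_near_gtr Uoo A) => n An; apply: lt_trans An _.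
  by case: (htx n).
have xU : \forall n \near U, `|(tx n).2| <= 1 by apply: filterE => n; case: (htx n).
have [l yl] := sg_orbit_cvg sgS acS M0 SM UU tU xU.
have rl := sg_orbit_lim_reversible sgS acS M0 SM UU tU xU yl.
have : phi (tx n).2 *: u @[n --> U] --> l.
  rewrite (span_u rl); apply: cvgZr_tmp.
  apply: cvg_trans (dual_cvg UU phiD yl); apply: near_eq_cvg.
  apply: filterE => n; rewrite invariant_all //; case: (htx n) => nt _ _.
  exact: le_lt_trans nt.
have e4 : 0 < e / 4 by rewrite divr_gt0.
move=> /cvgrPdist_le /(_ _ e4) h1; have /cvgrPdist_le /(_ _ e4) h2 := yl.
have [n [h3 h4]] := filter_ex (filterI h1 h2).
have [_ _] := htx n; rewrite leNgt => /negP; apply.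
have -> : S (tx n).1 (tx n).2 - phi (tx n).2 *: u =
    (l - phi (tx n).2 *: u) - (l - S (tx n).1 (tx n).2).
  by rewrite opprB [RHS]addrC addrA subrK.
apply: le_lt_trans (ler_normB _ _) _; apply: le_lt_trans (lerD h3 h4) _.
by lra.
Qed.

End Line.

End Convergence.

Theorem theorem3p4 (R : realType) (E : completeNormedModType R)
  (L : banach_lattice E) (S : R -> E -> E) :
  semigroup S -> positive_sg L S -> irreducible_sg L S ->
  growth_bound S = 0%E -> asymptotically_compact S ->
  exists (u : E) (phi : E -> R),
    quasi_interior L u /\ strictly_positive L phi /\
    opnorm (S t \- rank_one phi u) @[t --> +oo] --> (0 : R).
Proof.
move=> sgS posS irrS gbS acS.
have [phi [phi0 phi1]] := invariant_functional sgS posS gbS acS.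
have [M M0 SM] := sg_bounded sgS posS irrS gbS acS phi0 phi1.
have [U [UU Uoo]] := free_ultrafilter.
have [u [ru u0 pu su]] :=
  reversible_line sgS posS irrS acS phi0 phi1 M0 SM UU Uoo gbS.
have un : u <> 0.
  move=> uz; have := oner_neq0 R; rewrite -pu uz.
  by rewrite (@lin_zero _ _ R^o _ phi0.1.1) eqxx.
have fixu t : 0 < t -> S t u = u.
  exact: (fixed_line sgS posS phi0 phi1 M0 SM ru u0 pu su).
have inv t x : 0 < t -> phi (S t x) = phi x.
  exact: (invariant_all sgS posS acS phi0 phi1 M0 SM UU Uoo ru u0 pu su).
exists u, phi; split; [|split].
- by apply: (quasi_interior_eigen irrS u0 un) => t /fixu ->; exists 1; rewrite scale1r.
- split; first by case: phi0.
  by move=> f f0; have [t [t0]] := irrS _ _ f0 phi0; rewrite inv.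
- apply/cvgrPdist_le => e e0.
  have [n hn] := uniform_convergence sgS posS acS phi0 phi1 M0 SM UU Uoo ru u0 pu su e0.
  exists n%:R; split; first exact: num_real.
  move=> t nt; have h x : `|(S t \- rank_one phi u) x| <= e * `|x| by exact: hn.
  rewrite sub0r normrN ger0_norm; first by apply: opnorm_le => //; exact: ltW.
  by apply: opnorm_ge0; exists e.
Qed.
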